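(* Let $t_0<t_1$, $x_0,x_1\in\mathbb{R}^n$, $0<\alpha\le 1$, $\beta>0$, and let $L=L(t,x,y)$ be a real-valued function of $(t,x,y)\in[t_0,t_1]\times\mathbb{R}^n\times\mathbb{R}^n$. Let $x^0\in PC^{\alpha}([t_0,t_1],\mathbb{R}^n)$ deliver a weak local minimum in the problem $$(P)\qquad J(x(\cdot))=\int_{t_0}^{t_1}(t_1-t)^{\beta-1}L\big(t,x(t),({}^{c}D_{t_0+}^{\alpha}x)(t)\big)\,dt,\qquad x(t_0)=x_0,\ x(t_1)=x_1,$$ considered in $PC^{\alpha}([t_0,t_1],\mathbb{R}^n)$. Assume that $L,L_x,L_y,L_{xx},L_{xy},L_{yy}$ are continuous in some neighborhood of the graph $\{(t,x^0(t),({}^{c}D_{t_0+}^{\alpha}x^0)(t)) : t\in[t_0,t_1]\}$. Let $T_1\subset(t_0,t_1)$ be the set of continuity points of ${}^{c}D_{t_0+}^{\alpha}x^0$ and let $P(t)=L_{yy}(t,x^0(t),({}^{c}D_{t_0+}^{\alpha}x^0)(t))$. Then $$\langle P(t)r,r\rangle\ge0\qquad\text{for all } t\in T_1 \text{ and all } r\in\mathbb{R}^n.$$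
   Context: For $\alpha>0$: $(I_{t_0+}^{\alpha}\varphi)(t)=\frac{1}{\Gamma(\alpha)}\int_{t_0}^{t}(t-\tau)^{\alpha-1}\varphi(\tau)\,d\tau$ (left-sided Riemann–Liouville fractional integral), and $I^0_{t_0+}\varphi=\varphi$. For $0<\alpha\le1$ the left-sided Caputo derivative of a continuous $\varphi$ is $({}^{c}D_{t_0+}^{\alpha}\varphi)(t)=\frac{d}{dt}\big(I_{t_0+}^{1-\alpha}(\varphi(\cdot)-\varphi(t_0))\big)(t)$, where $I_{t_0+}^{1-\alpha}(\varphi(\cdot)-\varphi(t_0))$ is required to be absolutely continuous on $[t_0,t_1]$. $PC^{\alpha}([t_0,t_1],\mathbb{R}^n)$ is the set of continuous functions $\varphi:[t_0,t_1]\to\mathbb{R}^n$ whose Caputo derivative ${}^{c}D_{t_0+}^{\alpha}\varphi$ is continuous everywhere on $[t_0,t_1]$ except at finitely many points of $(t_0,t_1)$, where it has discontinuities of the first kind (finite one-sided limits). Functions $x\in PC^{\alpha}([t_0,t_1],\mathbb{R}^n)$ satisfying the boundary conditions of $(P)$ are admissible. An admissible $x^0$ delivers a weak local minimum in $(P)$ if there is $\delta>0$ such that $J(x(\cdot))\ge J(x^0(\cdot))$ for every admissible $x$ with $\sup_{t}\|x(t)-x^0(t)\|+\sup_{t}\|({}^{c}D_{t_0+}^{\alpha}(x-x^0))(t)\|<\delta$, the second supremum being over the points where the derivative is defined. $L_x,L_y$ are the gradients and $L_{xx},L_{xy},L_{yy}$ the matrices of second partial derivatives of $L$ in the vector variables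 $x,y$; $\langle\cdot,\cdot\rangle$ is the scalar product in $\mathbb{R}^n$. Neighborhoods are relative to $[t_0,t_1]\times\mathbb{R}^n\times\mathbb{R}^n$. At a discontinuity point of ${}^{c}D_{t_0+}^{\alpha}x^0$ the graph is understood to contain the points corresponding to both one-sided limits. *)

(* Defs.v *)
From HB Require Import structures.
From mathcomp Require Import all_boot all_order all_algebra.
From mathcomp Require Import all_classical all_reals all_analysis.

Set Implicit Arguments.
Unset Strict Implicit.
Unset Printing Implicit Defensive.

Import Order.TTheory GRing.Theory Num.Theory.
Import numFieldNormedType.Exports.

Local Open Scope classical_set_scope.
Local Open Scope ring_scope.

(* Functions on [t0, t1] are represented by total functions on R; every
   definition below only depends on their values on [t0, t1]. *)

Definition dotv (R : realType) (n : nat) (u v : 'rV[R]_n) : R :=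
  \sum_(i < n) u 0 i * v 0 i.

(* The library norm on 'rV[R]_n is the max norm; this is the Euclidean one. *)
Definition enorm (R : realType) (n : nat) (u : 'rV[R]_n) : R :=
  Num.sqrt (dotv u u).

Definition Gamma (R : realType) (a : R) : R :=
  \int[@lebesgue_measure R]_(s in `]0, +oo[) (s `^ (a - 1) * expR (- s)).

Definition RL_integral (R : realType) (n : nat) (t0 a : R)
    (phi : R -> 'rV[R]_n) (t : R) : 'rV[R]_n :=
  if a == 0 then phi t else
  \row_(i < n) ((Gamma a)^-1 *
    \int[@lebesgue_measure R]_(s in `[t0, t]) ((t - s) `^ (a - 1) * phi s 0 i)).

(* The pairs in s are the endpoints of non-overlapping subintervals. *)
Definition abs_continuous (R : realType) (n : nat) (a b : R)
    (F : R -> 'rV[R]_n) : Prop :=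
  forall e : R, 0 < e -> exists2 d : R, 0 < d &
    forall s : seq (R * R),
      all (fun p => [&& a <= p.1, p.1 <= p.2 & p.2 <= b]) s ->
      pairwise (fun p q => (p.2 <= q.1) || (q.2 <= p.1)) s ->
      \sum_(p <- s) (p.2 - p.1) < d ->
      \sum_(p <- s) enorm (F p.2 - F p.1) < e.

(* One-sided at the endpoints t0 and t1. *)
Definition diff_quot_filter (R : realType) (n : nat) (t0 t1 : R)
    (F : R -> 'rV[R]_n) (t : R) : set_system 'rV[R]_n :=
  (s - t)^-1 *: (F s - F t) @[s --> within `[t0, t1] t^'].

Definition caputo_primitive (R : realType) (n : nat) (t0 al : R)
    (phi : R -> 'rV[R]_n) : R -> 'rV[R]_n :=
  RL_integral t0 (1 - al) (fun s => phi s - phi t0).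

Definition caputo_defined (R : realType) (n : nat) (t0 t1 al : R)
    (phi : R -> 'rV[R]_n) (t : R) : Prop :=
  cvg (diff_quot_filter t0 t1 (caputo_primitive t0 al phi) t).

(* Meaningful only at the points t where caputo_defined holds. *)
Definition caputo (R : realType) (n : nat) (t0 t1 al : R)
    (phi : R -> 'rV[R]_n) (t : R) : 'rV[R]_n :=
  lim (diff_quot_filter t0 t1 (caputo_primitive t0 al phi) t).

Definition caputo_continuous_at (R : realType) (n : nat) (t0 t1 al : R)
    (phi : R -> 'rV[R]_n) (t : R) : Prop :=
  caputo_defined t0 t1 al phi t /\
  caputo t0 t1 al phi s @[s --> within `[t0, t1] (nbhs t)]
    --> caputo t0 t1 al phi t.

Definition PC (R : realType) (n : nat) (t0 t1 al : R)
    (phi : R -> 'rV[R]_n) : Prop :=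
  [/\ {within `[t0, t1], continuous phi},
      abs_continuous t0 t1 (caputo_primitive t0 al phi) &
      exists S : seq R,
        [/\ forall t, t \in S -> t0 < t < t1,
            forall t, t0 <= t <= t1 -> t \notin S ->
              caputo_continuous_at t0 t1 al phi t &
            forall t, t \in S ->
              cvg (caputo t0 t1 al phi s @[s --> t^'-]) /\
              cvg (caputo t0 t1 al phi s @[s --> t^'+])]].

Definition functional (R : realType) (n : nat) (t0 t1 al be : R)
    (L : R -> 'rV[R]_n -> 'rV[R]_n -> R) (x : R -> 'rV[R]_n) : R :=
  \int[@lebesgue_measure R]_(t in `[t0, t1])
    ((t1 - t) `^ (be - 1) * L t (x t) (caputo t0 t1 al x t)).

Definition admissible (R : realType) (n : nat) (t0 t1 : R) (xa xb : 'rV[R]_n)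
    (al : R) (x : R -> 'rV[R]_n) : Prop :=
  [/\ PC t0 t1 al x, x t0 = xa & x t1 = xb].

Definition weak_norm (R : realType) (n : nat) (t0 t1 al : R)
    (h : R -> 'rV[R]_n) : \bar R :=
  (ereal_sup [set (enorm (h t))%:E | t in [set t | t0 <= t <= t1]%R] +
   ereal_sup [set (enorm (caputo t0 t1 al h t))%:E |
     t in [set t | (t0 <= t <= t1)%R /\ caputo_defined t0 t1 al h t]])%E.

Definition weak_local_min (R : realType) (n : nat) (t0 t1 : R)
    (xa xb : 'rV[R]_n) (al be : R) (L : R -> 'rV[R]_n -> 'rV[R]_n -> R)
    (x0 : R -> 'rV[R]_n) : Prop :=
  admissible t0 t1 xa xb al x0 /\
  exists2 delta : R, 0 < delta &
    forall x : R -> 'rV[R]_n, admissible t0 t1 xa xb al x ->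
      (weak_norm t0 t1 al (fun t => x t - x0 t)%R < delta%:E)%E ->
      functional t0 t1 al be L x >= functional t0 t1 al be L x0.

(* At an interior continuity point the one-sided limits are the value itself,
   so the second alternative only adds points at the discontinuities. *)
Definition caputo_graph (R : realType) (n : nat) (t0 t1 al : R)
    (x : R -> 'rV[R]_n) : set (R * 'rV[R]_n * 'rV[R]_n) :=
  [set p | let t := p.1.1 in let y := p.2 in
    [/\ t0 <= t <= t1, p.1.2 = x t &
      (caputo_defined t0 t1 al x t /\ y = caputo t0 t1 al x t) \/
      (t0 < t < t1 /\
        (caputo t0 t1 al x s @[s --> t^'-] --> y \/
         caputo t0 t1 al x s @[s --> t^'+] --> y))]].

Section second_order_partials.
Variables (R : realType) (n : nat).
Implicit Types (f : 'rV[R]_n -> R) (g : 'rV[R]_n -> 'rV[R]_n).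
Implicit Type L : R -> 'rV[R]_n -> 'rV[R]_n -> R.

Definition has_partials f (x : 'rV[R]_n) : Prop :=
  forall i : 'I_n, derivable f x (delta_mx 0 i).

Definition grad f (x : 'rV[R]_n) : 'rV[R]_n :=
  \row_(i < n) 'D_(delta_mx 0 i) f x.

(* Entry (i, j) is the j-th partial derivative of the i-th component of g. *)
Definition jac g (x : 'rV[R]_n) : 'M[R]_n :=
  \matrix_(i < n, j < n) 'D_(delta_mx 0 j) (fun z => g z 0 i) x.

Definition Lx L t x y := grad (fun z => L t z y) x.
Definition Ly L t x y := grad (fun z => L t x z) y.
Definition Lxx L t x y := jac (fun z => Lx L t z y) x.
Definition Lxy L t x y := jac (fun z => Lx L t x z) y.
Definition Lyy L t x y := jac (fun z => Ly L t x z) y.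

Definition has_second_partials L t x y : Prop :=
  [/\ has_partials (fun z => L t z y) x,
      has_partials (fun z => L t x z) y,
      forall i, has_partials (fun z => Lx L t z y 0 i) x,
      forall i, has_partials (fun z => Lx L t x z 0 i) y &
      forall i, has_partials (fun z => Ly L t x z 0 i) y].

Definition uncurry3 (T : Type) (F : R -> 'rV[R]_n -> 'rV[R]_n -> T)
    (p : R * 'rV[R]_n * 'rV[R]_n) : T := F p.1.1 p.1.2 p.2.

Definition C2_on (A : set (R * 'rV[R]_n * 'rV[R]_n)) L : Prop :=
  (forall t x y, A (t, x, y) -> has_second_partials L t x y) /\
  [/\ {within A, continuous (uncurry3 L)},
      {within A, continuous (uncurry3 (Lx L))} &
      {within A, continuous (uncurry3 (Ly L))}] /\
  [/\ {within A, continuous (uncurry3 (Lxx L))},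
      {within A, continuous (uncurry3 (Lxy L))} &
      {within A, continuous (uncurry3 (Lyy L))}].

End second_order_partials.

(* A neighborhood relative to [t0, t1] x R^n x R^n is the trace on that set of
   an open U. *)
Definition C2_near_graph (R : realType) (n : nat) (t0 t1 al : R)
    (L : R -> 'rV[R]_n -> 'rV[R]_n -> R) (x0 : R -> 'rV[R]_n) : Prop :=
  exists U : set (R * 'rV[R]_n * 'rV[R]_n),
    [/\ open U, caputo_graph t0 t1 al x0 `<=` U &
        C2_on (U `&` [set p | t0 <= p.1.1 <= t1]) L].

(* Main.v *)
Require Import Defs.
From HB Require Import structures.
From mathcomp Require Import all_boot all_order all_algebra.
From mathcomp Require Import all_classical all_reals all_analysis.
From mathcomp Require Import measurable_realfun.
From mathcomp Require Import ring lra.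

Set Implicit Arguments.
Unset Strict Implicit.
Unset Printing Implicit Defensive.

Import Order.TTheory GRing.Theory Num.Theory.
Import numFieldNormedType.Exports.

Local Open Scope classical_set_scope.
Local Open Scope ring_scope.

(* Suppose <P(tau) r, r> < 0 and perturb x0 by +-lam g r, where
   g = (t-a)_+^al - (1+m) (t-b)_+^al + m (t-tau)_+^al, a = tau - 2e, b = tau - e,
   and m in [0, 1] makes g vanish at t1. The Caputo derivative of g is a positive
   constant times the step function 1 on (a, b), -m on (b, tau), 0 elsewhere. The
   symmetric second difference J(x0 + lam g r) + J(x0 - lam g r) - 2 J(x0) has no
   first-order part, so the Euler equation is not needed. On [a, tau] it
   contributes at most lam^2 (-c e + O(e^(1+al))), the negative term coming from
   L_yy on (a, b). Although g does not vanish on [tau, t1], there |g| <= e^al and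
   |g| <= e (t-tau)^(al-1), so g^2 contributes only O(e^(1+al)). For small e the
   total is negative, against minimality. *)

(** For al < 1 the obstacle is memory: a variation whose Caputo derivative lives on a short interval
    does not vanish after it, so the value at t1 must be arranged and a tail on [tau, t1] paid for.
    The two-node bump (t-a)_+^al - (t-b)_+^al is positive at t1; the third node adds the one free
    parameter m that cancels it, and m <= 1 because the increments of s^al over equal steps
    decrease. The tail must cost o(e) against a gain of order e. Squaring |g| <= e^al gives e^(2
    al), too large when al <= 1/2; squaring |g| <= e (t-tau)^(al-1) gives a non-integrable power for
    the same al. The product of the two bounds avoids both defects. On [a, tau] the mixed and L_xx
    terms carry a factor |g| <= e^al on an interval of length 2e. All estimates are exact
    inequalities with the common factor lam^2, not expansions as lam -> 0: e is fixed first, through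
    constants independent of e, and lam afterwards only has to keep the perturbed curves where L is
    controlled and inside the weak neighborhood. *)

(** * Affine changes of variable in Lebesgue integrals *)

Section affine_change_of_variable.
Variable R : realType.
Notation mu := (@lebesgue_measure R).

Let aff (k b : R) : measurableTypeR R -> measurableTypeR R := fun x => k * x + b.

Let measurable_aff k b : measurable_fun setT (aff k b).
Proof.
have m : measurable_fun setT (fun x : R => k * x + b).
  by apply: measurable_funD => //; exact: mulrl_measurable.
exact: m.
Qed.

(** Both sides are measures that agree on half-open intervals, where [k] compensates the rescaling
    of the preimage; uniqueness of Lebesgue measure gives the rest. *)
Lemma lebesgue_measure_affine (k b : R) (k0 : 0 < k) (A : set R) :
  measurable A ->
  mu A = (k%:E * pushforward mu (aff k b) A)%E.
Proof.
pose mfi := isMeasurableFun.Build _ _ _ _ _ (@measurable_aff k b).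
pose fp : {mfun measurableTypeR R >-> measurableTypeR R} := HB.pack (aff k b) mfi.
move=> mA; apply: (@lebesgue_measure_unique R (mscale (NngNum (ltW k0)) (pushforward mu fp))) => //= _ [[a c]] _ <-.
rewrite /mscale /= /pushforward.
have -> : aff k b @^-1` `]a, c] = `](a - b) / k, (c - b) / k]%classic.
  apply/seteqP; split => x /=; rewrite !in_itv /= ltr_pdivrMr // ler_pdivlMr //
    (mulrC x) ltrBlDr lerBrDr //.
rewrite !lebesgue_measure_itv /= !lte_fin ltr_pM2r ?invr_gt0 // ltrD2r.
case: ifPn => // _; last by rewrite mule0.
rewrite -!EFinD -EFinM; congr EFin; field; exact: lt0r_neq0.
Qed.

Lemma ge0_integral_affine (k b : R) (D : set R) (f : R -> \bar R) : 0 < k ->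
  measurable D -> measurable_fun D f -> (forall x, D x -> (0 <= f x)%E) ->
  (\int[mu]_(x in D) f x =
   k%:E * \int[mu]_(x in (fun x => k * x + b)%R @^-1` D) f (k * x + b)%R)%E.
Proof.
move=> k0 mD mf f0.
pose mfi := isMeasurableFun.Build _ _ _ _ _ (@measurable_aff k b).
pose fp : {mfun measurableTypeR R >-> measurableTypeR R} := HB.pack (aff k b) mfi.
have := @ge0_integral_pushforward _ _ _ _ _ (aff k b) (measurable_aff k b) mu D f mD mf.
rewrite /comp /aff => <-; last by move=> y /set_mem; exact: f0.
pose nu : {measure set (measurableTypeR R) -> \bar R} := pushforward mu fp.
transitivity (\int[mscale (NngNum (ltW k0)) (nu (measurable_aff k b))]_(x in D) f x)%E.
  by apply: eq_measure_integral => A mA AD; exact: lebesgue_measure_affine.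
by rewrite ge0_integral_mscale.
Qed.

(** The affine rule needs a positive factor, so the reflection is a translation followed by
    invariance of the measure under negation. *)
Lemma ge0_integral_reflect (t : R) (D : set R) (f : R -> \bar R) :
  measurable D -> measurable_fun D f -> (forall x, D x -> (0 <= f x)%E) ->
  (\int[mu]_(x in D) f x =
   \int[mu]_(x in (fun x => t - x)%R @^-1` D) f (t - x)%R)%E.
Proof.
move=> mD mf f0.
rewrite (@ge0_integral_affine 1 t) // mul1e.
under eq_integral do rewrite mul1r.
set h := fun x => f (x + t)%R.
have mh : measurable ((fun x => 1 * x + t)%R @^-1` D).
  by rewrite -[X in measurable X]setTI; apply: (measurable_funD _ _ _ mD).
rewrite -[LHS]/(\int[mu]_(x in (fun x : R => (1 * x + t)%R) @^-1` D) h x)%E.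
transitivity (\int[pushforward mu (-%R : _ -> measurableTypeR R)]_(x in (fun x => 1 * x + t)%R @^-1` D) h x)%E.
  by apply: eq_measure_integral => A mA AD; apply/esym; exact: lebesgue_measureN.
rewrite ge0_integral_pushforward //; last 2 first.
- apply: measurable_comp mf _; rewrite //.
    by move=> _ [x /= Dx <-]; move: Dx; rewrite mul1r.
  by apply: measurable_funD.
- by move=> y /set_mem /= Dy; apply: f0; move: Dy; rewrite mul1r.
rewrite (_ : (-%R : _ -> measurableTypeR R) @^-1` _ = (fun x => t - x)%R @^-1` D); last first.
  by apply/seteqP; split => x /=; rewrite mul1r addrC.
by apply: eq_integral => x _ /=; rewrite /h addrC.
Qed.

End affine_change_of_variable.

(** * Powers: integrability, concavity inequalities, Gamma and Abel integrals *)

Section power_integrals.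
Variable R : realType.
Notation mu := (@lebesgue_measure R).

Lemma continuous_powR_gt0 (p x : R) : 0 < x -> {for x, continuous (fun s => s `^ p)}.
Proof.
move=> x0; apply: differentiable_continuous; rewrite -derivable1_diffP.
by apply: derivable_powR; rewrite in_itv /= andbT.
Qed.

Lemma powR_continuous_within (p a b : R) : 0 < a ->
  {within `[a, b], continuous (fun s => s `^ p)}.
Proof.
move=> a0; apply: derivable_within_continuous => x; rewrite in_itv /= => /andP[ax _].
by apply: derivable_powR; rewrite in_itv /= andbT (lt_le_trans a0).
Qed.

(** The bound does not depend on [a], so it survives the limit a -> 0; a positive [a] keeps the
    possible singularity at 0 outside the interval. *)
Lemma integral_powR_le (p a b : R) : 0 < p -> 0 < a -> a < b ->
  (\int[mu]_(s in `[a, b]) (s `^ (p - 1))%:E <= (b `^ p / p)%:E)%E.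
Proof.
move=> p0 a0 ab.
have pos x : a <= x -> x \in `]0, +oo[ by move=> ax; rewrite in_itv /= andbT (lt_le_trans a0).
have cp x : a <= x -> {for x, continuous (fun x => x `^ p / p)}.
  move=> ax; apply: cvgM; last exact: cvg_cst.
  by apply: continuous_powR_gt0; rewrite (lt_le_trans a0).
rewrite (@continuous_FTC2 _ _ (fun x => x `^ p / p)) //.
- rewrite -EFinB lee_fin gerBl; apply: divr_ge0; [exact: powR_ge0|exact: ltW].
- exact: powR_continuous_within.
- split.
  + move=> x; rewrite in_itv /= => /andP[/ltW ax _].
    by apply: derivableM => //; apply: derivable_powR; exact: pos.
  + by apply: cvg_at_right_filter; apply: cp.
  + by apply: cvg_at_left_filter; apply: cp; exact: ltW.
- move=> x; rewrite in_itv /= => /andP[/ltW ax _].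
  have d : derivable (fun x => x `^ p) x 1 by apply: derivable_powR; exact: pos.
  rewrite derive1E deriveMr // -derive1E powR_derive1; last exact: pos.
  by rewrite mulrA mulVf ?mul1r // lt0r_neq0.
Qed.

Lemma measurable_powR_fun (p : R) (D : set R) :
  measurable_fun D (fun s => (s `^ p)%:E).
Proof.
by apply/measurable_EFinP; apply: measurable_funTS; exact: measurable_powR.
Qed.

Lemma integral_powR_lty (p b : R) : 0 < p -> 0 < b ->
  (\int[mu]_(s in `]0%R, b]) (s `^ (p - 1))%:E < +oo)%E.
Proof.
move=> p0 b0.
(* Monotone exhaustion of ]0, b]; the shift [i.+2] makes every interval nondegenerate, as
   [integral_powR_le] requires. *)
pose F (i : nat) : set R := `[b / i.+2%:R, b]%classic.
have -> : `]0, b]%classic = \bigcup_i F i.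
  apply/seteqP; split => x /=; rewrite ?in_itv /=.
    move=> /andP[x0 xb].
    have [i _ /(_ i (leqnn i)) ib] : \forall i \near \oo, b / x < (i : nat)%:R.
      exact: nbhs_infty_gtr.
    exists i => //; rewrite /F /= in_itv /= xb andbT ler_pdivrMr // mulrC -ler_pdivrMr //.
    by rewrite (le_trans (ltW ib)) // ler_nat; apply: leqW; apply: leqW.
  move=> [i _]; rewrite /F /= in_itv /= => /andP[bx ->]; rewrite andbT.
  by apply: lt_le_trans bx; rewrite divr_gt0.
apply: (@le_lt_trans _ _ (b `^ p / p)%:E); last exact: ltry.
have mF i : measurable (F i) by exact: measurable_itv.
have ndF : nondecreasing_seq F.
  move=> i j ij; apply/subsetPset => x; rewrite /F /= !in_itv /= => /andP[bx ->].
  rewrite andbT (le_trans _ bx) // ler_pM2l // lef_pV2 ?posrE // ler_nat.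
  by rewrite !ltnS.
have : (\int[mu]_(s in F i) (s `^ (p - 1))%:E @[i --> \oo] -->
    \int[mu]_(s in \bigcup_i F i) (s `^ (p - 1))%:E)%E.
  apply: ge0_nondecreasing_set_cvg_integral => //.
    by move=> i; exact: measurable_powR_fun.
  by move=> i x _; rewrite lee_fin powR_ge0.
move=> /cvg_lim <- //.
apply: lime_le.
  apply: ereal_nondecreasing_is_cvgn.
  apply: ge0_nondecreasing_set_nondecreasing_integral => //.
  by move=> i; exact: measurable_powR_fun.
  by move=> i x _; rewrite lee_fin powR_ge0.
near=> i; apply: integral_powR_le => //; first by rewrite divr_gt0.
by rewrite ltr_pdivrMr // -[ltLHS]mulr1 ltr_pM2l // (ltr_nat _ 1).
Unshelve. all: by end_near. Qed.

Lemma integrable_abel_kernel (p a t : R) : 0 < p ->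
  mu.-integrable `[a, t] (fun s => ((t - s) `^ (p - 1))%:E).
Proof.
move=> p0; wlog at_ : a / a < t => [hw|].
  have /hw : Num.min a (t - 1) < t by rewrite gt_min gtrBl ltr01 orbT.
  apply: integrableS => //.
  by move=> x /=; rewrite !in_itv /= => /andP[ax ->]; rewrite ge_min ax.
have m q (D : set R) : measurable_fun D (fun s => ((t - s) `^ q)%:E).
  apply/measurable_EFinP; apply: measurable_funTS.
  apply: (@measurableT_comp _ _ _ _ _ _ (fun s => s `^ q)); first exact: measurable_powR.
  exact: measurable_funB.
apply/integrableP; split; first exact: m.
under eq_integral do rewrite gee0_abs ?lee_fin ?powR_ge0 //.
have : (\int[mu]_(x in `[0%R, (t - a)%R]) (x `^ (p - 1))%:E =
    \int[mu]_(x in (fun x : R => (t - x)%R) @^-1` `[0%R, (t - a)%R]) ((t - x) `^ (p - 1))%:E)%E.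
  apply: ge0_integral_reflect => //; first exact: measurable_powR_fun.
  by move=> x _; rewrite lee_fin powR_ge0.
rewrite (_ : (fun x => t - x) @^-1` `[0, t - a] = `[a, t]%classic); last first.
  by apply/seteqP; split => x /=; rewrite !in_itv /= subr_ge0 lerD2l lerN2 andbC.
move=> <-; rewrite -integral_itv_obnd_cbnd; last exact: measurable_powR_fun.
by apply: integral_powR_lty => //; rewrite subr_gt0.
Qed.

Lemma integrable_powR_shift (p a b : R) : 0 < p ->
  mu.-integrable `[a, b] (fun s => ((s - a) `^ (p - 1))%:E).
Proof.
move=> p0; wlog at_ : b / a < b => [hw|].
  have /hw : a < Num.max b (a + 1) by rewrite lt_max ltrDl ltr01 orbT.
  apply: integrableS => //.
  by move=> x /=; rewrite !in_itv /= => /andP[-> xb]; rewrite le_max xb.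
have m q (D : set R) : measurable_fun D (fun s => ((s - a) `^ q)%:E).
  apply/measurable_EFinP; apply: measurable_funTS.
  apply: (@measurableT_comp _ _ _ _ _ _ (fun s => s `^ q)); first exact: measurable_powR.
  exact: measurable_funB.
apply/integrableP; split; first exact: m.
under eq_integral do rewrite gee0_abs ?lee_fin ?powR_ge0 //.
have : (\int[mu]_(x in `[0%R, (b - a)%R]) (x `^ (p - 1))%:E = 1%:E *
    \int[mu]_(x in (fun x : R => (1 * x - a)%R) @^-1` `[0%R, (b - a)%R]) ((1 * x - a) `^ (p - 1))%:E)%E.
  apply: ge0_integral_affine => //; first exact: measurable_powR_fun.
  by move=> x _; rewrite lee_fin powR_ge0.
rewrite mul1e.
rewrite (_ : (fun x => 1 * x - a) @^-1` `[0, b - a] = `[a, b]%classic); last first.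
  by apply/seteqP; split => x /=; rewrite !in_itv /= mul1r subr_ge0 lerD2r.
under [in RHS]eq_integral do rewrite mul1r.
move=> <-; rewrite -integral_itv_obnd_cbnd; last exact: measurable_powR_fun.
by apply: integral_powR_lty => //; rewrite subr_gt0.
Qed.

(** [Gamma] is the [fine] part of an extended integral and would be 0 if that integral were
    infinite, so positivity includes finiteness. The integrand is dominated by s^(a-1) on ]0, 1] and
    by exp(-s) beyond 1; the lower bound comes from ]0, 1]. *)
Lemma Gamma_gt0 (a : R) : 0 < a -> a <= 1 -> 0 < Gamma a.
Proof.
move=> a0 a1; rewrite /Gamma /Rintegral.
have m D : measurable_fun D (fun s : R => (s `^ (a - 1) * expR (- s))%:E).
  apply/measurable_EFinP; apply: measurable_funTS; apply: measurable_funM.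
    exact: measurable_powR.
  by apply: measurableT_comp; [exact: measurable_expR|exact: oppr_measurable].
have f0 s : (0 <= (s `^ (a - 1) * expR (- s))%:E :> \bar R)%E.
  by rewrite lee_fin mulr_ge0 ?powR_ge0 ?expR_ge0.
have i0 : (0 < \int[mu]_(s in `]0%R, 1%R]) (s `^ (a - 1) * expR (- s))%:E)%E.
  apply: (@lt_le_trans _ _ (\int[mu]_(s in `]0%R, 1%R]) (expR (-1))%:E)%E).
    rewrite integral_cst //= lebesgue_measure_itv /= lte_fin ltr01.
    by rewrite -EFinD subr0 mule1 lte_fin expR_gt0.
  apply: ge0_le_integral => //=.
  - exact: m.
  move=> x; rewrite in_itv /= => /andP[x0 x1].
  rewrite lee_fin -[leLHS]mul1r; apply: ler_pM; rewrite ?expR_ge0 //.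
    rewrite -[leLHS](powRr0 x); apply: ger_powR; first by rewrite x0.
    by rewrite subr_le0.
  by rewrite ler_expR lerN2.
have ilt : (\int[mu]_(s in `]0%R, +oo[) (s `^ (a - 1) * expR (- s))%:E < +oo)%E.
  rewrite (@itv_bndbnd_setU _ _ _ (BRight (1 : R))) ?bnd_simp //.
  rewrite ge0_integral_setU //=; last first.
    rewrite -[[disjoint _ & _]]/([disjoint `]0, 1] & `]1, +oo[]%classic).
    apply/disj_setPS => x [] /=; rewrite !in_itv /= andbT => /andP[_ x1].
    by rewrite ltNge x1.
  - exact: m.
  apply: lte_add_pinfty.
    apply: le_lt_trans (integral_powR_lty a0 ltr01).
    apply: ge0_le_integral => //=.
    - exact: m.
    - exact: measurable_powR_fun.
    move=> x; rewrite in_itv /= => /andP[x0 x1].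
    rewrite lee_fin ler_piMr ?powR_ge0 // -expR0 ler_expR oppr_le0 ltW //.
  apply: (@le_lt_trans _ _ (\int[mu]_(s in `[0%R, +oo[) (expR (- s))%:E)%E).
    apply: (@le_trans _ _ (\int[mu]_(s in `]1%R, +oo[) (expR (- s))%:E)%E).
      apply: ge0_le_integral => //=.
      - exact: m.
      - apply/measurable_EFinP; apply: measurable_funTS.
        by apply: measurableT_comp; [exact: measurable_expR|exact: oppr_measurable].
      move=> x; rewrite in_itv /= andbT => x1.
      rewrite lee_fin ler_piMl ?expR_ge0 // -[leRHS](powRr0 x); apply: ler_powR; first exact: ltW.
      by rewrite subr_le0.
    apply: ge0_subset_integral => //=.
    - apply/measurable_EFinP; apply: measurable_funTS.
      by apply: measurableT_comp; [exact: measurable_expR|exact: oppr_measurable].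
    - by move=> x /=; rewrite !in_itv /= !andbT => x1; rewrite ltW // (lt_trans _ x1).
  rewrite (@ge0_continuous_FTC2y _ (fun s => expR (- s)) (fun s => - expR (- s)) 0 0) //.
  - by rewrite -EFinB ltry.
  - apply: continuous_subspaceT => x.
    by apply: continuous_comp; [exact: oppr_continuous|exact: continuous_expR].
  - rewrite -oppr0; apply: cvgN; exact: cvgr_expR.
  - apply: cvg_at_right_filter; apply: cvgN.
    by apply: continuous_comp; [exact: oppr_continuous|exact: continuous_expR].
  - move=> x _; rewrite derive1E; apply: (@derive_val _ _ _ x).
    apply: is_derive_eq; by rewrite ?scaleN1r ?opprK ?scaler1 ?mulrN1 ?mulN1r ?opprK.
rewrite fine_gt0 // ilt andbT; apply: lt_le_trans i0 _.
apply: ge0_subset_integral => //=; first exact: m.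
by move=> x /=; rewrite !in_itv /= => /andP[-> _].
Qed.

(** By scaling: u <= u^p on ]0, 1], applied to the fractions x/(x+e) and e/(x+e), which add up to
    1. *)
Lemma powRD_le (p x e : R) : 0 < p -> p <= 1 -> 0 <= x -> 0 <= e ->
  (x + e) `^ p <= x `^ p + e `^ p.
Proof.
move=> p0 p1; rewrite le_eqVlt => /predU1P[<- e0|x0].
  by rewrite add0r lerDr powR_ge0.
rewrite le_eqVlt => /predU1P[<-|e0]; first by rewrite addr0 lerDl powR_ge0.
have s0 : 0 < x + e by exact: addr_gt0.
have H y : 0 < y -> y <= x + e -> y / (x + e) * (x + e) `^ p <= y `^ p.
  move=> y0 ys; have -> : y `^ p = (y / (x + e)) `^ p * (x + e) `^ p.
    by rewrite -powRM ?divr_ge0 ?ltW // divfK // lt0r_neq0.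
  rewrite ler_wpM2r ?powR_ge0 //; apply: ger1_powR => //.
  by rewrite divr_gt0 //= ler_pdivrMr // mul1r.
have := lerD (H x x0 _) (H e e0 _); rewrite -mulrDl -mulrDl divff ?lt0r_neq0 // mul1r.
by apply; rewrite ?lerDl ?lerDr ltW.
Qed.

(** After factoring out x^p this is (1+u)^p <= 1+u with u = e/x, true because the base is at least 1
    and p <= 1. *)
Lemma powRD_le_tangent (p x e : R) : p <= 1 -> 0 < x -> 0 <= e ->
  (x + e) `^ p <= x `^ p + e * x `^ (p - 1).
Proof.
move=> p1 x0 e0.
have xe : 1 <= 1 + e / x by rewrite lerDl divr_ge0 // ltW.
have -> : x + e = x * (1 + e / x) by field; exact: lt0r_neq0.
rewrite powRM ?(ltW x0) ?(le_trans ler01 xe) //.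
have -> : x `^ p + e * x `^ (p - 1) = x `^ p * (1 + e / x).
  rewrite powRB ?lt0r_neq0 ?implybT // powRr1 ?ltW //; field; exact: lt0r_neq0.
by rewrite ler_wpM2l ?powR_ge0 // ler1_powR.
Qed.

Lemma powR_le_anti (q x y : R) : q <= 0 -> 0 < x -> x <= y -> y `^ q <= x `^ q.
Proof.
move=> q0 x0 xy; have y0 := lt_le_trans x0 xy.
have -> : q = - - q by rewrite opprK.
rewrite powRN [leRHS]powRN lef_pV2 ?posrE ?powR_gt0 //.
by apply: ge0_ler_powR; rewrite ?nnegrE ?oppr_ge0 ?(ltW x0) ?(ltW y0).
Qed.

(** Concavity: each increment is p c^(p-1) e for some c in its own interval, and c^(p-1) decreases
    from one interval to the next. This is the source of the bound m <= 1. *)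
Lemma powR_second_diff_le (p d e : R) : 0 < p -> p <= 1 -> 0 < d -> 0 < e ->
  (d + 2 * e) `^ p - (d + e) `^ p <= (d + e) `^ p - d `^ p.
Proof.
move=> p0 p1 d0 e0.
have H (a : R) : 0 < a -> exists2 c : R, a <= c <= a + e &
    (a + e) `^ p - a `^ p = p * c `^ (p - 1) * e.
  move=> a0; have ae : a <= a + e by rewrite lerDl ltW.
  have [x xa||c] := @MVT_segment R (fun x => x `^ p) (fun x => p * x `^ (p - 1)) a (a + e) ae.
  - apply: is_derive1_powR; move: xa; rewrite in_itv /= => /andP[ax _].
    exact: lt_trans ax.
  - exact: powR_continuous_within.
  rewrite in_itv /= => ac E; exists c => //; rewrite E; congr (_ * _).
  by rewrite addrC addKr.
have [c1 /andP[a1 b1] E1] := H _ d0.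
have [c2 /andP[a2 b2] E2] := H _ (addr_gt0 d0 e0).
have -> : d + 2 * e = d + e + e by ring.
rewrite E1 E2 ler_pM2r // ler_pM2l //; apply: powR_le_anti.
- by rewrite subr_le0.
- exact: lt_le_trans a1.
- exact: le_trans b1 a2.
Qed.

(** The Beta value B(1 - al, al + 1). *)
Definition beta_abel (al : R) : R :=
  \int[mu]_(s in `[0, 1]) ((1 - s) `^ (1 - al - 1) * s `^ al).

Let abel_integrand_measurable (al t a : R) (D : set R) :
  measurable_fun D (fun s : R => ((t - s) `^ (1 - al - 1) * (s - a) `^ al)%:E).
Proof.
apply/measurable_EFinP; apply: measurable_funTS; apply: measurable_funM.
  apply: (@measurableT_comp _ _ _ _ _ _ (fun s => s `^ _)); first exact: measurable_powR.
  exact: measurable_funB.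
apply: (@measurableT_comp _ _ _ _ _ _ (fun s => s `^ _)); first exact: measurable_powR.
exact: measurable_funB.
Qed.

Let beta_abel_fin (al : R) : 0 < al -> al < 1 ->
  (\int[mu]_(s in `[0%R, 1%R]) ((1 - s) `^ (1 - al - 1) * s `^ al)%:E < +oo)%E.
Proof.
move=> al0 al1.
have p0 : 0 < 1 - al by rewrite subr_gt0.
have /integrableP[m +] := integrable_abel_kernel 0 1 p0.
apply: le_lt_trans; apply: ge0_le_integral => //=.
- by move=> x _; rewrite lee_fin mulr_ge0 ?powR_ge0.
- have := @abel_integrand_measurable al 1 0 `[0, 1].
  by apply: eq_measurable_fun => x _; rewrite subr0.
- by have := measurableT_comp (@abse_measurable R setT) m.
move=> x; rewrite in_itv /= => /andP[x0 x1].
rewrite lee_fin ger0_norm ?powR_ge0 // ler_piMr ?powR_ge0 //.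
have -> : 1 = 1 `^ al :> R by rewrite powR1.
by apply: ge0_ler_powR; rewrite ?nnegrE ?(ltW al0).
Qed.

Lemma beta_abel_gt0 (al : R) : 0 < al -> al < 1 -> 0 < beta_abel al.
Proof.
move=> al0 al1; rewrite /beta_abel /Rintegral fine_gt0 // beta_abel_fin // andbT.
have m D : measurable_fun D (fun s : R => ((1 - s) `^ (1 - al - 1) * s `^ al)%:E).
  have := @abel_integrand_measurable al 1 0 D.
  by apply: eq_measurable_fun => x _; rewrite subr0.
(* On [1/2, 1[ the kernel is at least 1 and the power at least 2^(-al). The point 1 is left out
   because a nonzero power of 0 is 0 by convention. *)
apply: (@lt_le_trans _ _ (\int[mu]_(s in `[2^-1%R, 1%R[) (2^-1 `^ al)%:E)%E).
  rewrite integral_cst //= lebesgue_measure_itv /= lte_fin invf_lt1 ?ltr1n ?ltr0n //.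
  rewrite -EFinD -EFinM lte_fin mulr_gt0 ?powR_gt0 ?invr_gt0 //.
  by rewrite subr_gt0 invf_lt1 ?ltr1n.
apply: (@le_trans _ _ (\int[mu]_(s in `[2^-1%R, 1%R[) ((1 - s) `^ (1 - al - 1) * s `^ al)%:E)%E).
  apply: ge0_le_integral => //=.
  - exact: m.
  move=> x; rewrite in_itv /= => /andP[x0 x1].
  have x0' : 0 < x by apply: lt_le_trans x0; rewrite invr_gt0.
  rewrite lee_fin -[leLHS]mul1r; apply: ler_pM; rewrite ?powR_ge0 //.
    have one : 1 `^ (1 - al - 1) = 1 :> R by rewrite powR1.
    rewrite -[leLHS]one; apply: powR_le_anti; rewrite ?subr_gt0 //.
      by rewrite lerBlDr add0r lerBlDr lerDl ltW.
    by rewrite gerBl ltW.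
  by apply: ge0_ler_powR; rewrite ?nnegrE ?(ltW al0) ?invr_ge0 // ltW.
apply: ge0_subset_integral => //=.
- exact: m.
- by move=> x _; rewrite lee_fin mulr_ge0 ?powR_ge0.
- move=> x /=; rewrite !in_itv /= => /andP[x0 x1]; rewrite (ltW x1) andbT.
  by apply: le_trans x0; rewrite invr_ge0.
Qed.

(** The substitution s = a + (t - a) u reduces the integral to [beta_abel]. The result is linear in
    t beyond [a], which is why powers of exponent [al] are the building blocks of the test
    function. *)
Lemma abel_integral_power (al t0 a t : R) : 0 < al -> al < 1 -> t0 <= a ->
  \int[mu]_(s in `[t0, t]) ((t - s) `^ (1 - al - 1) * (Num.max (s - a) 0) `^ al)
  = beta_abel al * Num.max (t - a) 0.
Proof.
move=> al0 al1 t0a; have [ta|at_] := leP t a.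
  rewrite max_r ?subr_le0 // mulr0 (@eq_Rintegral _ _ _ _ _ (cst 0)) ?Rintegral_cst ?mul0r //.
  move=> s /set_mem /=; rewrite in_itv /= => /andP[_ st].
  by rewrite max_r ?subr_le0 ?(le_trans st) // powR0 ?mulr0 // lt0r_neq0.
have ta0 : 0 < t - a by rewrite subr_gt0.
rewrite max_l ?subr_ge0 ?(ltW at_) // /Rintegral.
have -> : (\int[mu]_(x in `[t0, t]) ((t - x) `^ (1 - al - 1) * Num.max (x - a)%R 0 `^ al)%:E =
    \int[mu]_(x in `[a, t]) ((t - x) `^ (1 - al - 1) * (x - a) `^ al)%:E)%E.
  rewrite integral_mkcond [RHS]integral_mkcond; apply: eq_integral => x _.
  rewrite !patchE; case: ifPn => [/set_mem|/negP H].
    rewrite /= in_itv /= => /andP[t0x xt]; case: ifPn => [/set_mem|/negP H].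
      by rewrite /= in_itv /= => /andP[ax _]; rewrite max_l // subr_ge0.
    rewrite max_r ?powR0 ?mulr0 ?lt0r_neq0 // subr_le0 leNgt; apply/negP => ax.
    by apply: H; apply/mem_set; rewrite /= in_itv /= xt ltW.
  case: ifPn => // /set_mem; rewrite /= in_itv /= => /andP[ax xt].
  by exfalso; apply: H; apply/mem_set; rewrite /= in_itv /= xt (le_trans t0a).
rewrite (@ge0_integral_affine R (t - a) a) //; last first.
  by move=> x _; rewrite lee_fin mulr_ge0 ?powR_ge0.
rewrite (_ : (fun x => (t - a) * x + a) @^-1` `[a, t] = `[0, 1]%classic); last first.
  have le1 x : ((t - a) * x + a <= t) = (x <= 1).
    by rewrite -lerBrDr -[leRHS]mulr1 (ler_pM2l ta0).
  by apply/seteqP; split => x /=; rewrite !in_itv /= lerDr pmulr_rge0 // le1.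
have -> : (\int[mu]_(x in `[0%R, 1%R]) ((t - ((t - a) * x + a)) `^ (1 - al - 1) *
     ((t - a) * x + a - a) `^ al)%:E = \int[mu]_(s in `[0%R, 1%R])
     ((1 - s) `^ (1 - al - 1) * s `^ al)%:E)%E.
  apply: eq_integral => x /set_mem /=; rewrite in_itv /= => /andP[x0 x1].
  congr EFin; rewrite addrK.
  have -> : t - ((t - a) * x + a) = (t - a) * (1 - x) by ring.
  (* The exponents [1 - al - 1] and [al] add up to 0, so the powers of t - a cancel and only the
     Jacobian remains. *)
  rewrite !powRM ?subr_ge0 ?(ltW at_) // mulrACA -powRD; last by rewrite lt0r_neq0 // implybT.
  by rewrite (_ : 1 - al - 1 + al = 0) ?powRr0 ?mul1r //; ring.
rewrite fineM //; first by rewrite /beta_abel /Rintegral [LHS]mulrC.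
rewrite ge0_fin_numE; first exact: beta_abel_fin.
by apply: integral_ge0 => x _; rewrite lee_fin mulr_ge0 ?powR_ge0.
Qed.

End power_integrals.

(** * Mean values and symmetric second differences *)

Section one_variable.
Variable R : realType.
Implicit Types (g dg : R -> R) (a b c e M s : R).

(** The endpoints are unordered because the increments to which this is applied may have either
    sign. *)
Lemma mean_value g dg a b :
  (forall s, Num.min a b <= s <= Num.max a b -> is_derive s 1 g (dg s)) ->
  exists2 s, Num.min a b <= s <= Num.max a b & g b - g a = dg s * (b - a).
Proof.
wlog ab : a b / a <= b => [hw|].
  case/orP: (le_total a b) => [ab|ba]; first exact: hw.
  rewrite minC maxC => H; have [s Hs E] := hw _ _ ba H.
  by exists s => //; rewrite -opprB E -mulrN opprB.
rewrite min_l // max_r // => dgE.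
have [x||s] := @MVT_segment _ g dg a b ab.
- by rewrite in_itv /= => /andP[p q]; apply: dgE; rewrite !ltW.
-  apply: derivable_within_continuous => x; rewrite in_itv /= => /dgE d.
  exact: ex_derive.
by rewrite in_itv /= => sab E; exists s.
Qed.

Lemma between0_norm b s : Num.min 0 b <= s <= Num.max 0 b -> `|s| <= `|b|.
Proof.
have [b0|b0] := leP 0 b => /andP[s1 s2].
  by rewrite !ger0_norm.
by rewrite !ler0_norm ?(ltW b0) // lerN2.
Qed.

(** Two nested mean values; they lose the factor 1/2 of Taylor's formula, which is harmless here. *)
Lemma taylor1_bound g dg ddg b C :
  (forall s, `|s| <= `|b| -> is_derive s 1 g (dg s)) ->
  (forall s, `|s| <= `|b| -> is_derive s 1 dg (ddg s)) ->
  (forall s, `|s| <= `|b| -> `|ddg s| <= C) ->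
  `|g b - g 0 - dg 0 * b| <= C * b ^+ 2.
Proof.
move=> H1 H2 HC.
have [s /between0_norm sb ->] := @mean_value g dg 0 b (fun s sb => H1 s (between0_norm sb)).
have [s' /between0_norm s's E] := @mean_value dg ddg 0 s
  (fun s' sb' => H2 s' (le_trans (between0_norm sb') sb)).
rewrite subr0 -mulrBl E subr0 !normrM -mulrA.
rewrite -(ger0_norm (sqr_ge0 b)) expr2 normrM; apply: ler_pM => //.
  by apply: HC; exact: le_trans s's sb.
by apply: ler_pM.
Qed.

(** The bound on [ddg] is one-sided and [M] may be negative: this is how the negative sign of the
    quadratic form reaches the functional. *)
Lemma second_difference_le g dg ddg b M :
  (forall s, `|s| <= `|b| -> is_derive s 1 g (dg s)) ->
  (forall s, `|s| <= `|b| -> is_derive s 1 dg (ddg s)) ->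
  (forall s, `|s| <= `|b| -> ddg s <= M) ->
  g b + g (- b) - 2 * g 0 <= M * b ^+ 2.
Proof.
wlog b0 : b / 0 <= b => [hw|].
  have [b0|/ltW b0] := leP 0 b; first exact: hw.
  have := hw (- b); rewrite oppr_ge0 normrN sqrrN opprK (addrC (g (- b))).
  exact.
rewrite (ger0_norm b0) => H1 H2 HM.
(* Comparison with the parabola M s^2: for s >= 0 the mean value theorem for [dg] on [-s, s] gives
   psi' <= 0, hence psi b <= psi 0. *)
pose psi s := g s + g (- s) - M * s ^+ 2.
pose dpsi s := dg s - dg (- s) - M * (2 * s).
have dpsiE s : Num.min 0 b <= s <= Num.max 0 b -> is_derive s 1 psi (dpsi s).
  move=> /between0_norm; rewrite (ger0_norm b0) => sb.
  have d1 := H1 _ sb.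
  have d2 : is_derive (- s) 1 g (dg (- s)) by apply: H1; rewrite normrN.
  have d3 : is_derive s 1 (fun s => g (- s)) (- dg (- s)).
    have := @is_derive1_comp _ g -%R s (dg (- s)) (-1) d2.
    by rewrite mulrN1; apply; apply: is_deriveNid.
  rewrite /psi /dpsi.
  have d4 : is_derive s 1 (fun s => M * s ^+ 2) (M * (2 * s)).
    have := @is_deriveZ _ _ _ _ M _ _ _ (@is_deriveX _ _ id 2 s 1 1 _).
    rewrite /= expr1 [_ *: 1]mulr1; apply.
  exact: is_deriveB.
have [s sb E] := mean_value dpsiE.
have s0 : 0 <= s by move: sb; rewrite min_l // => /andP[].
have {}sb : s <= b by move: sb; rewrite max_r // => /andP[].
have [s' /andP[s'1 s'2] E'] : exists2 s', - s <= s' <= s & dg s - dg (- s) = ddg s' * (s - - s).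
  have := @mean_value dg ddg (- s) s; rewrite min_l ?max_r; last 2 first.
  - by rewrite ge0_cp.
  - by rewrite ge0_cp.
  apply => u /andP[u1 u2]; apply: H2; rewrite ler_norml (le_trans u2 sb) andbT.
  by rewrite (le_trans _ u1) // lerN2.
have HM' : ddg s' <= M.
  apply: HM; rewrite ler_norml (le_trans s'2 sb) andbT.
  by rewrite (le_trans _ s'1) // lerN2.
suff : psi b - psi 0 <= 0.
  by rewrite /psi oppr0 expr0n /= mulr0; lra.
rewrite E /dpsi E' opprK subr0; apply: mulr_le0_ge0 => //.
by have : ddg s' * s <= M * s by [rewrite ler_wpM2r]; lra.
Qed.

(** Expanding in the first variable at q = Q and q = -Q leaves the linear terms (a 0 Q - a 0 (-Q))
    P, of size |P||Q| by the mean value theorem in q, and a pure second difference in q at p = 0.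
    Only the latter has to keep its sign. *)
Lemma second_difference2_le (l a axx : R -> R -> R) (axy b byy : R -> R) (P Q C M : R) :
  (forall p q : R, `|p| <= `|P| -> `|q| <= `|Q| -> is_derive p (1 : R) (l^~ q) (a p q)) ->
  (forall p q : R, `|p| <= `|P| -> `|q| <= `|Q| -> is_derive p (1 : R) (a^~ q) (axx p q)) ->
  (forall q : R, `|q| <= `|Q| -> is_derive q (1 : R) (a 0) (axy q)) ->
  (forall q : R, `|q| <= `|Q| -> is_derive q (1 : R) (l 0) (b q)) ->
  (forall q : R, `|q| <= `|Q| -> is_derive q (1 : R) b (byy q)) ->
  (forall p q : R, `|p| <= `|P| -> `|q| <= `|Q| -> `|axx p q| <= C) ->
  (forall q : R, `|q| <= `|Q| -> `|axy q| <= C) ->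
  (forall q : R, `|q| <= `|Q| -> byy q <= M) ->
  l P Q + l (- P) (- Q) - 2 * l 0 0 <=
    2 * C * P ^+ 2 + 2 * C * (`|P| * `|Q|) + M * Q ^+ 2.
Proof.
move=> d1 d2 d3 d4 d5 Cxx Cxy My.
have e1 := @second_difference_le (l 0) b byy Q M d4 d5 My.
have e2 : `|l P Q - l 0 Q - a 0 Q * P| <= C * P ^+ 2.
  by apply: (@taylor1_bound (l^~ Q) (a^~ Q) (axx^~ Q)) => s sP; [exact: d1|exact: d2|exact: Cxx].
have e3 : `|l (- P) (- Q) - l 0 (- Q) - a 0 (- Q) * (- P)| <= C * (- P) ^+ 2.
  by apply: (@taylor1_bound (l^~ (- Q)) (a^~ (- Q)) (axx^~ (- Q))) => s;
    rewrite normrN => sP; [apply: d1|apply: d2|apply: Cxx]; rewrite ?normrN.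
have QQ q : Num.min (- Q) Q <= q <= Num.max (- Q) Q -> `|q| <= `|Q|.
  have [Q0|/ltW Q0] := leP 0 Q.
    by rewrite min_l ?max_r ?ge0_cp // (ger0_norm Q0) ler_norml.
  by rewrite min_r ?max_l ?le0_cp // (ler0_norm Q0) ler_norml opprK.
have [q /QQ Hq e4] := @mean_value (a 0) axy (- Q) Q (fun q Hq => d3 q (QQ q Hq)).
have e5 : (a 0 Q - a 0 (- Q)) * P <= 2 * C * (`|P| * `|Q|).
  apply: le_trans (ler_norm _) _; rewrite e4 opprK !normrM.
  have -> : Q + Q = 2 * Q by ring.
  rewrite normrM [`|2|]ger0_norm //.
  have := ler_wpM2r (mulr_ge0 (normr_ge0 P) (normr_ge0 Q)) (Cxy q Hq).
  by lra.
move: e2 e3 e1; rewrite sqrrN !ler_norml => /andP[_ e2] /andP[_ e3] e1.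
by lra.
Qed.

End one_variable.

(** * Directional derivatives from continuous partial derivatives *)

Section partials.
Variables (R : realType) (n : nat).
Implicit Types (f : 'rV[R]_n -> R) (x y v z e r : 'rV[R]_n).

Lemma is_derive_line f z e s d : is_derive (z + s *: e) e f d ->
  is_derive s 1 (fun s : R => f (z + s *: e)) d.
Proof.
move=> [df <-].
have E : (fun h : R => h^-1 *: (((fun s : R => f (z + s *: e)) \o shift s) (h *: 1) - f (z + s *: e))) =
         (fun h : R => h^-1 *: ((f \o shift (z + s *: e)) (h *: e) - f (z + s *: e))).
  by apply/funext => h /=; rewrite [h *: 1]mulr1 scalerDl addrCA.
by split; rewrite ?/derivable ?/derive E.
Qed.

(** The increment is split along a path parallel to the axes; on each edge the mean value theorem
    produces a partial derivative at a nearby point, close to its value at [x] by continuity. *)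
Lemma is_derive_partials f x v : (\forall z \near x, has_partials f z) ->
  (forall i, {for x, continuous (fun z => 'D_(delta_mx 0 i) f z)}) -> is_derive x v f (dotv (grad f x) v).
Proof.
move=> hp cg.
suff H : h^-1 *: ((f \o shift x) (h *: v) - f x) @[h --> 0^'] --> dotv (grad f x) v.
  by split; [apply/cvg_ex; exists (dotv (grad f x) v)|exact: cvg_lim H].
(* The l1 norm of [v] bounds each coordinate and sums the errors of all edges; N + 1 avoids dividing
   by 0 when v = 0. *)
pose N : R := \sum_(i < n) `|v 0 i|.
have N0 : 0 <= N by apply: sumr_ge0.
have vN i : `|v 0 i| <= N.
  by rewrite /N (bigD1 i) //= lerDl; apply: sumr_ge0.
apply/cvgrPdist_le => e e0.
pose e' := e / (N + 1).
have e'0 : 0 < e' by rewrite divr_gt0 // ltr_wpDl.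
have /nbhs_ballP[d /= d0 Hd] : \forall z \near x, has_partials f z /\
    forall i, ball ('D_(delta_mx 0 i) f x) e' ('D_(delta_mx 0 i) f z).
  near=> z; split; first by near: z.
  near: z; apply: filter_forall => i; exact: (cvg_ball (cg i) e'0).
near=> h.
have h0 : h != 0 by near: h; exact: nbhs_dnbhs_neq.
have hd : `|h| * (N + 1) < d.
  rewrite -ltr_pdivlMr ?ltr_wpDl //; near: h; apply: dnbhs0_lt.
  by rewrite divr_gt0 // ltr_wpDl.
(* Vertices of the path: the first [k] coordinates have already been moved. *)
pose z (k : nat) : 'rV[R]_n := \row_i (x 0 i + (if (i < k)%N then h * v 0 i else 0)).
have zn : z n = h *: v + x.
  by apply/rowP => i; rewrite !mxE ltn_ord addrC.
have z0 : z 0%N = x by apply/rowP => i; rewrite !mxE ltn0 addr0.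
have zS (k : 'I_n) : z k.+1 = z k + (h * v 0 k) *: delta_mx 0 k.
  apply/rowP => i; rewrite !mxE eqxx /= ltnS leq_eqVlt.
  have [->|ik] := eqVneq i k; first by rewrite ltnn eqxx /= mulr1 addr0.
  by rewrite (inj_eq val_inj) (negbTE ik) /= mulr0 addr0.
have zball (k : 'I_n) s : `|s| <= `|h * v 0 k| -> ball x d (z k + s *: delta_mx 0 k).
  move=> sh; split=> // i j; rewrite ord1 !mxE eqxx /=.
  rewrite -ball_normE /ball_ /= -addrA opprD addrA subrr add0r normrN.
  have small w : `|h * w| <= `|h| * N -> `|h * w| < d.
    by move=> /le_lt_trans; apply; apply: le_lt_trans hd; rewrite ler_wpM2l // lerDl.
  have hv l : `|h * v 0 l| <= `|h| * N by rewrite normrM ler_wpM2l.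
  have [jk|jk] := eqVneq j k.
    rewrite jk ltnn mulr1 add0r.
    by apply: le_lt_trans sh _; apply: small.
  by rewrite mulr0 addr0; case: ifP => _; rewrite ?normr0 //; apply: small.
have step (k : 'I_n) : `|f (z k.+1) - f (z k) - grad f x 0 k * (h * v 0 k)| <= e' * `|h * v 0 k|.
  have [s /between0_norm sb] := @mean_value _ (fun s => f (z k + s *: delta_mx 0 k))
     (fun s => 'D_(delta_mx 0 k) f (z k + s *: delta_mx 0 k)) 0 (h * v 0 k)
     (fun s Hs => is_derive_line (derivableP ((Hd _ (zball k s (between0_norm Hs))).1 k))).
  rewrite -zS scale0r addr0 subr0 => ->; rewrite -mulrBl normrM ler_wpM2r //.
  have [_ /(_ k)] := Hd _ (zball k s sb).
  by rewrite -ball_normE /ball_ /= !mxE distrC => /ltW.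
rewrite /= -zn -{2}z0.
have -> : f (z n) - f (z 0%N) = \sum_(k < n) (f (z k.+1) - f (z k)).
  by rewrite -(big_mkord xpredT (fun k => f (z k.+1) - f (z k))) telescope_sumr.
rewrite /dotv scaler_sumr -sumrB.
apply: le_trans (ler_norm_sum _ _ _) _.
apply: (@le_trans _ _ (\sum_(k < n) e' * `|v 0 k|)).
  apply: ler_sum => k _.
  have -> : grad f x 0 k * v 0 k - h^-1 *: (f (z k.+1) - f (z k)) =
    - (h^-1 * (f (z k.+1) - f (z k) - grad f x 0 k * (h * v 0 k))).
    by rewrite -[_ *: _]/(_ * _); field.
  rewrite normrN normrM normfV ler_pdivrMl ?normr_gt0 //.
  by apply: le_trans (step k) _; rewrite normrM mulrCA.
rewrite -mulr_sumr -/N /e' mulrAC ler_pdivrMr ?ltr_wpDl // ler_wpM2l ?lerDl // ltW //.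
Unshelve. all: by end_near. Qed.

Definition qform (M : 'M[R]_n) (r : 'rV[R]_n) : R := dotv (M *m r^T)^T r.

Lemma is_derive_dotv_jac (G : 'rV[R]_n -> 'rV[R]_n) y r :
  (\forall z \near y, forall i, has_partials (fun w => G w 0 i) z) ->
  {for y, continuous (jac G)} ->
  is_derive y r (fun z => dotv (G z) r) (qform (jac G y) r).
Proof.
move=> hp cj.
have H i : is_derive y r (fun w => G w 0 i) (dotv (row i (jac G y)) r).
  have -> : row i (jac G y) = grad (fun w => G w 0 i) y by apply/rowP => j; rewrite !mxE.
  apply: is_derive_partials; first by near=> z; exact: (near hp).
  move=> j; have -> : (fun z => 'D_(delta_mx 0 j) (fun w => G w 0 i) z) =
      (fun M : 'M[R]_n => M i j) \o jac G by apply/funext => z /=; rewrite mxE.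
  by apply: continuous_comp => //; exact: coord_continuous.
have -> : (fun z => dotv (G z) r) = \sum_(i < n) (fun z => r 0 i *: G z 0 i).
  by apply/funext => z; rewrite fct_sumE; apply: eq_bigr => i _; rewrite mulrC.
have -> : qform (jac G y) r = \sum_(i < n) r 0 i *: dotv (row i (jac G y)) r.
  rewrite /qform {1}/dotv; apply: eq_bigr => i _; rewrite mulrC !mxE; congr (_ * _).
  by apply: eq_bigr => j _; rewrite !mxE.
by apply: is_derive_sum.
Unshelve. all: by end_near. Qed.

End partials.

(** * The test function and its fractional primitive *)

Section test_function.
Variable R : realType.
Notation mu := (@lebesgue_measure R).
Implicit Types (al a b c d m t s : R).

Lemma integrable_EFinZl (D : set R) q (f : R -> R) : measurable D ->
  mu.-integrable D (EFin \o f) -> mu.-integrable D (EFin \o (fun s => q * f s)).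
Proof.
move=> mD i; rewrite (_ : EFin \o _ = (fun x => q%:E * (EFin \o f) x)%E) //.
exact: integrableZl.
Qed.

Lemma integrable_EFinD (D : set R) (f g : R -> R) : measurable D ->
  mu.-integrable D (EFin \o f) -> mu.-integrable D (EFin \o g) ->
  mu.-integrable D (EFin \o (fun s => f s + g s)).
Proof.
move=> mD i j; rewrite (_ : EFin \o _ = ((EFin \o f) \+ (EFin \o g))%E) //.
exact: integrableD.
Qed.

Definition pos_powR al d t : R := (Num.max (t - d) 0) `^ al.

Lemma pos_powR_le0 al d t : 0 < al -> t <= d -> pos_powR al d t = 0.
Proof.
by move=> al0 td; rewrite /pos_powR max_r ?subr_le0 // powR0 // lt0r_neq0.
Qed.

Lemma pos_powR_ge al d t : d <= t -> pos_powR al d t = (t - d) `^ al.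
Proof. by move=> td; rewrite /pos_powR max_l ?subr_ge0. Qed.

Lemma pos_powR_continuous al d : 0 < al -> continuous (pos_powR al d).
Proof.
move=> al0 t; have [td|dt|<-] := ltgtP t d.
- apply: cvg_near_cst; near=> s.
  rewrite !pos_powR_le0 ?(ltW td) // ltW //; near: s; exact: lt_nbhsl.
- apply: (@cvg_trans _ ((s - d) `^ al @[s --> t])).
    apply: near_eq_cvg; near=> s; rewrite pos_powR_ge //.
    by apply: ltW; near: s; exact: lt_nbhsr.
  rewrite pos_powR_ge ?(ltW dt) //.
  apply: (@continuous_comp _ _ _ (fun s => s - d) (fun s => s `^ al)).
    by apply: cvgB => //; exact: cvg_cst.
  by apply: continuous_powR_gt0; rewrite subr_gt0.
(* At the kink the power need not be differentiable; the explicit radius e^(1/al) is used. *)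
- apply/cvgrPdist_le => e e0; rewrite (pos_powR_le0 al0 (lexx t)).
  near=> s; rewrite sub0r normrN ger0_norm ?powR_ge0 //.
  have -> : e = (e `^ al^-1) `^ al by rewrite -powRrM mulVf ?powRr1 ?ltW // lt0r_neq0.
  apply: ge0_ler_powR; rewrite ?nnegrE ?(ltW al0) ?powR_ge0 // ?le_max ?lexx ?orbT //.
  rewrite ge_max powR_ge0 andbT; apply: le_trans (ler_norm _) _.
  rewrite distrC; near: s; apply: (@cvgr_dist_le _ _ _ _ _ id t) => //.
  exact: powR_gt0.
Unshelve. all: by end_near. Qed.

Lemma pos_powR_diff_ge0 al d d' t : 0 < al -> d <= d' ->
  0 <= pos_powR al d t - pos_powR al d' t.
Proof.
move=> al0 dd'; rewrite subr_ge0 /pos_powR.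
have H : Num.max (t - d') 0 <= Num.max (t - d) 0.
  by rewrite ge_max !le_max lerD2l lerN2 dd' lexx orbT.
by apply: ge0_ler_powR; rewrite ?nnegrE ?(ltW al0) // le_max lexx orbT.
Qed.

Lemma pos_powR_diff_le al d d' t : 0 < al -> al <= 1 -> d <= d' ->
  pos_powR al d t - pos_powR al d' t <= (d' - d) `^ al.
Proof.
move=> al0 al1 dd'; rewrite lerBlDr.
have [td|dt] := leP t d'.
  rewrite (pos_powR_le0 al0 td) addr0 /pos_powR.
  apply: ge0_ler_powR; rewrite ?nnegrE ?(ltW al0) ?subr_ge0 // ?le_max ?lexx ?orbT //.
  by rewrite ge_max subr_ge0 dd' lerD2r td.
rewrite !pos_powR_ge ?(ltW dt) ?(le_trans dd' (ltW dt)) //.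
have -> : t - d = (t - d') + (d' - d) by ring.
by rewrite [leRHS]addrC; apply: powRD_le => //; rewrite subr_ge0 // ltW.
Qed.

Lemma pos_powR_diff_le_tangent al d d' t : 0 < al -> al <= 1 -> d <= d' -> d' < t ->
  pos_powR al d t - pos_powR al d' t <= (d' - d) * (t - d') `^ (al - 1).
Proof.
move=> al0 al1 dd' dt; rewrite lerBlDl.
rewrite !pos_powR_ge ?(ltW dt) ?(le_trans dd' (ltW dt)) //.
have -> : t - d = (t - d') + (d' - d) by ring.
by apply: powRD_le_tangent; rewrite ?subr_gt0 ?subr_ge0.
Qed.

(* The Caputo derivative of [bumpfun] is [caputo_cst al * slope], a step
   function supported in [a, c]; the coefficient [m] is chosen in [bump_coef] so
   that the bump vanishes at [t1], and concavity of [s `^ al] keeps it in [0, 1]. *)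
Definition bumpfun al a b c m t : R :=
  pos_powR al a t - (1 + m) * pos_powR al b t + m * pos_powR al c t.

(** Up to [caputo_cst al], the fractional primitive of [bumpfun]: piecewise linear for every
    [al]. *)
Definition tent a b c m t : R :=
  Num.max (t - a) 0 - (1 + m) * Num.max (t - b) 0 + m * Num.max (t - c) 0.

Definition slope a b c m t : R :=
  (a < t)%R%:R - (1 + m) * (b < t)%R%:R + m * (c < t)%R%:R.

Lemma bump_continuous al a b c m : 0 < al -> continuous (bumpfun al a b c m).
Proof.
move=> al0 t; apply: cvgD; [apply: cvgB|]; first exact: pos_powR_continuous.
- by apply: cvgM; [exact: cvg_cst|exact: pos_powR_continuous].
- by apply: cvgM; [exact: cvg_cst|exact: pos_powR_continuous].
Qed.

(* The factor in I^(1-al) (s - d)_+^al = caputo_cst al * (t - d)_+. Its value is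
   Gamma (al + 1), but only its sign matters. *)
Definition caputo_cst al : R :=
  if 1 - al == 0 then 1 else (Gamma (1 - al))^-1 * beta_abel al.

Lemma caputo_cst_gt0 al : 0 < al -> al <= 1 -> 0 < caputo_cst al.
Proof.
move=> al0 al1; rewrite /caputo_cst; case: ifPn => //; rewrite subr_eq0 => al1'.
have {}al1 : al < 1 by rewrite lt_neqAle eq_sym al1'.
rewrite mulr_gt0 ?invr_gt0 ?beta_abel_gt0 // Gamma_gt0 ?subr_gt0 //.
by rewrite gerBl ltW.
Qed.

Lemma integrable_abel_kernelM (p t0 t : R) (f : R -> R) : 0 < p ->
  {within `[t0, t], continuous f} ->
  mu.-integrable `[t0, t] (EFin \o (fun s => (t - s) `^ (p - 1) * f s)).
Proof.
move=> p0 cf.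
have H := integrable_abel_kernel t0 t p0.
have := @integrableMl _ _ _ mu `[t0, t] (measurable_itv _) _ f H.
apply.
- exact: subspace_continuous_measurable_fun.
- have /compact_bounded[M [_ mrt]] := continuous_compact cf (@segment_compact _ t0 t).
  by exists M; split; rewrite ?num_real // => ? ? ? ?; exact: mrt.
Qed.

Lemma caputo_primitive_bump n t0 al a b c m k (r : 'rV[R]_n) t :
  0 < al -> al <= 1 -> t0 <= a -> t0 <= b -> t0 <= c ->
  caputo_primitive t0 al (fun s => (k * bumpfun al a b c m s) *: r) t =
  (k * (caputo_cst al * tent a b c m t)) *: r.
Proof.
move=> al0 al1 t0a t0b t0c.
have b0 : bumpfun al a b c m t0 = 0.
  by rewrite /bumpfun !pos_powR_le0 // !mulr0 subr0 addr0.
rewrite /caputo_primitive /RL_integral b0 mulr0 scale0r /caputo_cst.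
(* For al = 1 the fractional integral has order 0, hence is the identity, and the bump is already
   piecewise linear. *)
case: ifPn => [|al1'].
  rewrite subr_eq0 => /eqP <-; rewrite subr0 mul1r.
  by rewrite /bumpfun /tent /pos_powR !powRr1 // le_max lexx orbT.
have {}al1 : al < 1 by move: al1'; rewrite subr_eq0 eq_sym lt_neqAle => ->.
have p0 : 0 < 1 - al by rewrite subr_gt0.
pose I d := \int[mu]_(s in `[t0, t]) ((t - s) `^ (1 - al - 1) * pos_powR al d s).
have ii d : mu.-integrable `[t0, t] (EFin \o (fun s => (t - s) `^ (1 - al - 1) * pos_powR al d s)).
  by apply: integrable_abel_kernelM => //; apply: continuous_subspaceT; exact: pos_powR_continuous.
have IE d : t0 <= d -> I d = beta_abel al * Num.max (t - d) 0 by exact: abel_integral_power.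
apply/rowP => i; rewrite !mxE.
under eq_Rintegral do rewrite subr0 mxE.
have -> : \int[mu]_(s in `[t0, t]) ((t - s) `^ (1 - al - 1) * (k * bumpfun al a b c m s * r 0 i)) =
    \int[mu]_(s in `[t0, t]) ((k * r 0 i) * ((t - s) `^ (1 - al - 1) * pos_powR al a s) +
      (- (k * r 0 i * (1 + m)) * ((t - s) `^ (1 - al - 1) * pos_powR al b s) +
       (k * r 0 i * m) * ((t - s) `^ (1 - al - 1) * pos_powR al c s))).
  by apply: eq_Rintegral => s _; rewrite /bumpfun; ring.
have iZ q d : mu.-integrable `[t0, t] (EFin \o (fun s => q * ((t - s) `^ (1 - al - 1) * pos_powR al d s))).
  by apply: integrable_EFinZl.
have iD : mu.-integrable `[t0, t] (EFin \o (fun s =>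
      - (k * r 0 i * (1 + m)) * ((t - s) `^ (1 - al - 1) * pos_powR al b s) +
       (k * r 0 i * m) * ((t - s) `^ (1 - al - 1) * pos_powR al c s))).
  by apply: integrable_EFinD.
rewrite RintegralD // RintegralD // !RintegralZl // -!/(I _) !IE // /tent.
by ring.
Qed.

(** Each positive part is 1-Lipschitz, so the constant is 1 + (1 + m) + m, at most 4. *)
Lemma tent_lipschitz a b c m s t : 0 <= m -> m <= 1 ->
  `|tent a b c m s - tent a b c m t| <= 4 * `|s - t|.
Proof.
move=> m0 m1.
have H d : `|Num.max (s - d) 0 - Num.max (t - d) 0| <= `|s - t|.
  have n1 := ler_norm (s - t).
  have n2 : t - s <= `|s - t| by rewrite distrC ler_norm.
  have n3 := normr_ge0 (s - t).
  by rewrite ler_norml; have [h1|h1] := leP (s - d) 0; have [h2|h2] := leP (t - d) 0;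
    apply/andP; split; lra.
have -> : tent a b c m s - tent a b c m t =
    (Num.max (s - a) 0 - Num.max (t - a) 0) - (1 + m) * (Num.max (s - b) 0 - Num.max (t - b) 0)
    + m * (Num.max (s - c) 0 - Num.max (t - c) 0) by rewrite /tent; ring.
apply: le_trans (ler_normD _ _) _.
apply: (@le_trans _ _ (`|s - t| + (1 + m) * `|s - t| + m * `|s - t|)).
  rewrite normrM (ger0_norm m0) lerD ?ler_wpM2l //.
  apply: le_trans (ler_normB _ _) _.
  by rewrite normrM [X in _ + X * _]ger0_norm ?addr_ge0 // lerD ?ler_wpM2l ?addr_ge0.
by have := ler_wpM2r (normr_ge0 (s - t)) m1; rewrite mul1r; lra.
Qed.

Lemma near_lt_eq d t : d != t -> \forall s \near t, (d < s) = (d < t).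
Proof.
move=> dt; have [|] := ltP d t => dt'.
  by near=> s; apply/idP; near: s; exact: lt_nbhsr.
have {}dt' : t < d by rewrite lt_neqAle eq_sym dt.
near=> s; apply/negbTE; rewrite -leNgt; apply: ltW; near: s; exact: lt_nbhsl.
Unshelve. all: by end_near. Qed.

Lemma near_left_lt_eq d t : \forall s \near t^'-, (d < s) = (d < t).
Proof.
have [|] := ltP d t => dt.
  by near=> s; apply/idP; near: s; exact: nbhs_left_gt.
near=> s; apply/negbTE; rewrite -leNgt; apply: le_trans dt; apply: ltW.
by near: s; exact: nbhs_left_lt.
Unshelve. all: by end_near. Qed.

(** The comparison with [t] is non-strict here and strict on the left: at d = t the step has
    different one-sided values. *)
Lemma near_right_lt_eq d t : \forall s \near t^'+, (d < s) = (d <= t).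
Proof.
have [dt|] := leP d t.
  near=> s; apply/idP; apply: le_lt_trans dt _; near: s; exact: nbhs_right_gt.
move=> dt; near=> s; apply/negbTE; rewrite -leNgt; apply: ltW.
by near: s; exact: nbhs_right_lt.
Unshelve. all: by end_near. Qed.

Lemma near_slope a b c m t : t \notin [:: a; b; c] ->
  \forall s \near t, slope a b c m s = slope a b c m t.
Proof.
rewrite !inE !negb_or => /and3P[ta tb tc]; near=> s.
rewrite /slope; congr (_%:R - _ * _%:R + _ * _%:R); congr nat_of_bool;
  by near: s; apply: near_lt_eq; rewrite eq_sym.
Unshelve. all: by end_near. Qed.

Lemma near_tent a b c m t : t \notin [:: a; b; c] ->
  \forall s \near t, tent a b c m s - tent a b c m t = slope a b c m t * (s - t).
Proof.
rewrite !inE !negb_or => /and3P[ta tb tc].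
have H d : t != d -> \forall s \near t,
    Num.max (s - d) 0 - Num.max (t - d) 0 = (d < t)%R%:R * (s - t).
  rewrite eq_sym => td; near=> s.
  have E : (d < s) = (d < t) by near: s; exact: near_lt_eq.
  have [dt|dt] := ltP d t.
    have ds : d < s by rewrite E.
    by rewrite !max_l ?subr_ge0 ?ltW // mul1r; ring.
  have ds : s <= d by rewrite leNgt E -leNgt.
  by rewrite !max_r ?subr_le0 // mul0r subr0.
near=> s.
have Ha : Num.max (s - a) 0 - Num.max (t - a) 0 = (a < t)%R%:R * (s - t) by near: s; exact: H.
have Hb : Num.max (s - b) 0 - Num.max (t - b) 0 = (b < t)%R%:R * (s - t) by near: s; exact: H.
have Hc : Num.max (s - c) 0 - Num.max (t - c) 0 = (c < t)%R%:R * (s - t) by near: s; exact: H.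
have -> : slope a b c m t * (s - t) = (a < t)%R%:R * (s - t) -
  (1 + m) * ((b < t)%R%:R * (s - t)) + m * ((c < t)%R%:R * (s - t)) by rewrite /slope; ring.
by rewrite -Ha -Hb -Hc /tent; ring.
Unshelve. all: by end_near. Qed.

End test_function.

(** * The Euclidean norm *)

Section euclidean.
Variables (R : realType) (n : nat).
Implicit Types u v r : 'rV[R]_n.

Lemma enormZ c r : enorm (c *: r) = `|c| * enorm r.
Proof.
rewrite /enorm /dotv.
have -> : \sum_(i < n) (c *: r) 0 i * (c *: r) 0 i = c ^+ 2 * \sum_(i < n) r 0 i * r 0 i.
  by rewrite mulr_sumr; apply: eq_bigr => i _; rewrite !mxE; ring.
by rewrite sqrtrM ?sqr_ge0 // sqrtr_sqr.
Qed.

Lemma enorm_ge0 u : 0 <= enorm u.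
Proof. exact: sqrtr_ge0. Qed.

Lemma le_enorm u v : (forall i, `|u 0 i| <= `|v 0 i|) -> enorm u <= enorm v.
Proof.
move=> H; rewrite /enorm ler_sqrt; last first.
  by apply: sumr_ge0 => i _; rewrite -expr2 sqr_ge0.
by apply: ler_sum => i _; rewrite -!expr2 -(real_normK (num_real (u 0 i)))
  -(real_normK (num_real (v 0 i))) ler_sqr.
Qed.

(** The factor 2 is affordable in absolute continuity and lets the squares be compared
    coordinatewise, with no Cauchy-Schwarz inequality. *)
Lemma enormD_le u v : enorm (u + v) <= 2 * (enorm u + enorm v).
Proof.
have E w : enorm w ^+ 2 = dotv w w.
  by rewrite sqr_sqrtr //; apply: sumr_ge0 => i _; rewrite -expr2 sqr_ge0.
have e0 := enorm_ge0.
rewrite -(@ler_sqr R) ?nnegrE ?e0 ?mulr_ge0 ?addr_ge0 ?e0 //.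
apply: (@le_trans _ _ (2 * (enorm u ^+ 2 + enorm v ^+ 2))).
  rewrite !E /dotv -big_split mulr_sumr; apply: ler_sum => i _ /=; rewrite !mxE.
  by have := sqr_ge0 (u 0 i - v 0 i); rewrite expr2; lra.
have := mulr_ge0 (e0 u) (e0 v); have := sqr_ge0 (enorm u); have := sqr_ge0 (enorm v).
by rewrite !expr2; lra.
Qed.

End euclidean.

(** * Neighborhoods avoiding finitely many points *)

Section near_finite.
Variable R : realType.
Implicit Types (t s : R) (P : R -> Prop).

Lemma near_notin (S : seq R) t : \forall s \near t^', s \notin S.
Proof.
elim: S => [|d S IH]; first exact: filterE.
have sd : \forall s \near t^', s != d.
  have [->|dt] := eqVneq d t; first exact: nbhs_dnbhs_neq.
  apply: cvg_within; case/orP: (lt_total dt) => dt'.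
    by near=> s; rewrite gt_eqF //; near: s; exact: lt_nbhsr.
  by near=> s; rewrite lt_eqF //; near: s; exact: lt_nbhsl.
by near=> s; rewrite inE negb_or; apply/andP; split; near: s.
Unshelve. all: by end_near. Qed.

Lemma near_notin_nbhs (S : seq R) t : t \notin S -> \forall s \near t, s \notin S.
Proof.
move=> tS; have := near_notin S t; rewrite /dnbhs near_withinE.
by apply: filterS => s sS; have [->//|/sS] := eqVneq s t.
Qed.

Lemma near_left_dnbhs P t : (\forall s \near t^', P s) -> \forall s \near t^'-, P s.
Proof.
rewrite /dnbhs /at_left !near_withinE; apply: filterS => s sP st; apply: sP.
by rewrite lt_eqF.
Qed.

Lemma near_right_dnbhs P t : (\forall s \near t^', P s) -> \forall s \near t^'+, P s.
Proof.
rewrite /dnbhs /at_right !near_withinE; apply: filterS => s sP st; apply: sP.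
by rewrite gt_eqF.
Qed.

Lemma cvg_within_interior (T : topologicalType) (f : R -> T) (a b t : R) (l : T) :
  a < t < b -> f s @[s --> within `[a, b] (nbhs t)] --> l -> f s @[s --> t] --> l.
Proof.
move=> tI H A NA.
have : \forall s \near within `[a, b] (nbhs t), A (f s) by exact: (H A NA).
rewrite near_withinE => {}H.
have I : \forall s \near t, s \in `]a, b[ by apply: near_in_itvoo; rewrite in_itv.
by apply: filterS2 H I => s Hs sI; apply: Hs; exact: subset_itv_oo_cc.
Qed.

End near_finite.

(** * The Caputo derivative of the perturbed curve *)

Section caputo_calculus.
Variables (R : realType) (n : nat) (t0 t1 al : R).
Hypotheses (t01 : t0 < t1) (al0 : 0 < al) (al1 : al <= 1).
Notation mu := (@lebesgue_measure R).
Implicit Types (x h F G H : R -> 'rV[R]_n) (l r : 'rV[R]_n) (t s : R).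

Let W t := within `[t0, t1] t^'.

Lemma near_within_dnbhs (P : R -> Prop) t :
  (\forall s \near t, P s) -> \forall s \near W t, P s.
Proof. by apply: filterS => s Ps _ _. Qed.

Lemma near_within_dnbhs_neq t : \forall s \near W t, s != t /\ t0 <= s <= t1.
Proof.
rewrite /W near_withinE /dnbhs near_withinE; apply: filterE => s st /=.
by rewrite in_itv.
Qed.

(** [caputo] is a [lim], and limits are unique only along a proper filter. Since t0 < t1, at least
    one side of [t] meets [t0, t1], endpoints included. *)
Lemma within_dnbhs_proper t : t0 <= t <= t1 -> ProperFilter (W t).
Proof.
move=> /andP[t0t tt1]; apply: Build_ProperFilter_ex => P.
rewrite -[W t P]/(\forall s \near W t, P s) /W near_withinE /dnbhs near_withinE => H.
have [tt1'|t1t] := ltP t t1.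
  have : \forall s \near t^'+, P s.
    near=> s; have st : t < s by near: s; exact: nbhs_right_gt.
    have : s != t -> `[t0, t1]%classic s -> P s by near: s; apply: cvg_within; exact: H.
    apply; first by rewrite gt_eqF.
    by rewrite /= in_itv /= (le_trans t0t (ltW st)) ltW //; near: s; exact: nbhs_right_lt.
  by move=> /filter_ex.
have t0t' : t0 < t by apply: lt_le_trans t1t.
have : \forall s \near t^'-, P s.
  near=> s; have st : s < t by near: s; exact: nbhs_left_lt.
  have : s != t -> `[t0, t1]%classic s -> P s by near: s; apply: cvg_within; exact: H.
  apply; first by rewrite lt_eqF.
  by rewrite /= in_itv /= (le_trans (ltW st) tt1) andbT ltW //; near: s; exact: nbhs_left_gt.
by move=> /filter_ex.
Unshelve. all: by end_near. Qed.

Lemma diff_quotD F G H t l r : t0 <= t <= t1 ->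
  (forall s, t0 <= s <= t1 -> H s = F s + G s) ->
  diff_quot_filter t0 t1 F t --> l -> diff_quot_filter t0 t1 G t --> r ->
  diff_quot_filter t0 t1 H t --> l + r.
Proof.
move=> tI HE cF cG; have pf := within_dnbhs_proper tI.
apply: (@cvg_trans _ ((s - t)^-1 *: (F s - F t) + (s - t)^-1 *: (G s - G t) @[s --> W t]));
  last exact: (cvgD cF cG).
apply: near_eq_cvg; near=> s.
have [st sI] : s != t /\ t0 <= s <= t1 by near: s; exact: near_within_dnbhs_neq.
by rewrite -scalerDr !HE // [in RHS]opprD [in RHS]addrACA.
Unshelve. all: by end_near. Qed.

Lemma caputo_unique x t l : t0 <= t <= t1 ->
  diff_quot_filter t0 t1 (caputo_primitive t0 al x) t --> l ->
  caputo_defined t0 t1 al x t /\ caputo t0 t1 al x t = l.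
Proof.
move=> tI cl; have pf := within_dnbhs_proper tI; split; first exact: cvgP cl.
by apply: cvg_lim cl; exact: norm_hausdorff.
Qed.

Lemma within_continuous_coord x (i : 'I_n) : {within `[t0, t1], continuous x} ->
  {within `[t0, t1], continuous (fun s => x s 0 i)}.
Proof.
move=> /subspace_continuousP cx; apply/subspace_continuousP => s sI.
exact: (cvg_comp _ _ (cx s sI) (@coord_continuous _ _ _ _ _ _)).
Qed.

Lemma caputo_primitiveD x h t : t0 <= t <= t1 ->
  {within `[t0, t1], continuous x} -> {within `[t0, t1], continuous h} ->
  caputo_primitive t0 al (fun s => x s + h s) t =
  caputo_primitive t0 al x t + caputo_primitive t0 al h t.
Proof.
move=> /andP[t0t tt1] cx ch; rewrite /caputo_primitive /RL_integral.
have E s : x s + h s - (x t0 + h t0) = (x s - x t0) + (h s - h t0) by rewrite opprD addrACA.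
case: ifPn => [_|p]; first exact: E.
have p0 : 0 < 1 - al by rewrite lt_neqAle eq_sym p subr_ge0.
have ii (y : R -> 'rV[R]_n) i : {within `[t0, t1], continuous y} -> mu.-integrable `[t0, t]
    (EFin \o (fun s => (t - s) `^ (1 - al - 1) * (y s - y t0) 0 i)).
  move=> cy; apply: integrable_abel_kernelM => //.
  apply: (@continuous_subspaceW _ _ _ `[t0, t1]).
    by move=> s /=; rewrite !in_itv /= => /andP[-> st]; exact: le_trans tt1.
  apply: within_continuous_coord; apply/subspace_continuousP => s sI.
  by apply: cvgB; [apply/subspace_continuousP: s sI|exact: cvg_cst].
apply/rowP => i; rewrite !mxE -mulrDr -RintegralD //; [|exact: ii|exact: ii].
by congr (_ * _); apply: eq_Rintegral => s _; rewrite E mxE mulrDr.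
Qed.

Variables (a b c m k : R) (r : 'rV[R]_n).
Hypotheses (t0a : t0 < a) (ab : a < b) (bc : b < c) (ct1 : c < t1).
Hypotheses (m0 : 0 <= m) (m1 : m <= 1).

Definition bump_variation (s : R) : 'rV[R]_n := (k * bumpfun al a b c m s) *: r.

Let kap := caputo_cst al.

Lemma bump_variation_continuous : {within `[t0, t1], continuous bump_variation}.
Proof.
apply: continuous_subspaceT => s; apply: cvgZl.
by apply: cvgM; [exact: cvg_cst|exact: bump_continuous].
Qed.

Lemma caputo_primitive_bump_variation s :
  caputo_primitive t0 al bump_variation s = (k * (kap * tent a b c m s)) *: r.
Proof.
apply: caputo_primitive_bump => //; first exact: ltW.
  by apply: ltW; apply: lt_trans ab.
by apply: ltW; apply: lt_trans bc; apply: lt_trans ab.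
Qed.

(** Away from the nodes the primitive is affine near [t], so the difference quotient is eventually
    constant. *)
Lemma diff_quot_bump_variation t : t \notin [:: a; b; c] ->
  diff_quot_filter t0 t1 (caputo_primitive t0 al bump_variation) t -->
  (k * (kap * slope a b c m t)) *: r.
Proof.
move=> tabc; apply: cvg_near_cst; near=> s.
have [st sI] : s != t /\ t0 <= s <= t1 by near: s; exact: near_within_dnbhs_neq.
have E : tent a b c m s - tent a b c m t = slope a b c m t * (s - t).
  by near: s; apply: near_within_dnbhs; exact: near_tent.
rewrite !caputo_primitive_bump_variation -scalerBl scalerA; congr (_ *: _).
have -> : k * (kap * tent a b c m s) - k * (kap * tent a b c m t) =
  k * (kap * (tent a b c m s - tent a b c m t)) by ring.
by rewrite E; field; rewrite subr_eq0.
Unshelve. all: by end_near. Qed.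

Lemma enorm_caputo_bump_variation t : t0 <= t <= t1 ->
  caputo_defined t0 t1 al bump_variation t ->
  enorm (caputo t0 t1 al bump_variation t) <= `|k| * (kap * 4) * enorm r.
Proof.
move=> tI cl; have pf := within_dnbhs_proper tI.
have kap0 : 0 <= kap by apply: ltW; exact: caputo_cst_gt0.
have q0 : 0 <= `|k| * (kap * 4) by rewrite !mulr_ge0.
rewrite -[X in X * _](ger0_norm q0) -enormZ; apply: le_enorm => i.
pose p := caputo_primitive t0 al bump_variation.
have ci : ((s - t)^-1 *: (p s - p t)) 0 i @[s --> W t] --> caputo t0 t1 al bump_variation t 0 i.
  exact: cvg_comp _ _ cl (@coord_continuous _ _ _ 0 i (caputo t0 t1 al bump_variation t)).
apply: (cvgr_to_le (cvg_norm ci)); rewrite /p; near=> s.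
have [st sI] : s != t /\ t0 <= s <= t1 by near: s; exact: near_within_dnbhs_neq.
rewrite /= !caputo_primitive_bump_variation -scalerBl scalerA !mxE !normrM.
rewrite ler_wpM2r // normfV ler_pdivrMl ?normr_gt0 ?subr_eq0 //.
have -> : k * (kap * tent a b c m s) - k * (kap * tent a b c m t) =
  k * (kap * (tent a b c m s - tent a b c m t)) by ring.
rewrite !normrM normr_id (ger0_norm kap0) [`|4|]ger0_norm // [leRHS]mulrCA ler_wpM2l //.
rewrite [leRHS]mulrCA ler_wpM2l // [leRHS]mulrC.
exact: tent_lipschitz.
Unshelve. all: by end_near. Qed.

Lemma weak_norm_bump_variation (B : R) :
  (forall t, t0 <= t <= t1 -> `|bumpfun al a b c m t| <= B) ->
  (weak_norm t0 t1 al bump_variation <= (`|k| * (B + kap * 4) * enorm r)%:E)%E.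
Proof.
move=> HB; rewrite mulrDr mulrDl EFinD; apply: leeD.
  apply: ge_ereal_sup => _ [t /= tI <-]; rewrite lee_fin enormZ normrM.
  by rewrite ler_wpM2r ?enorm_ge0 // ler_wpM2l // HB.
apply: ge_ereal_sup => _ [t /= [tI cd] <-]; rewrite lee_fin.
exact: enorm_caputo_bump_variation.
Qed.

Local Opaque caputo caputo_primitive.

Variable x : R -> 'rV[R]_n.
Hypothesis PCx : PC t0 t1 al x.

Let y s := x s + bump_variation s.

Lemma caputo_primitive_varied s : t0 <= s <= t1 ->
  caputo_primitive t0 al y s = caputo_primitive t0 al x s + caputo_primitive t0 al bump_variation s.
Proof.
by move=> sI; apply: caputo_primitiveD => //; [case: PCx|exact: bump_variation_continuous].
Qed.

Lemma caputo_varied t : t0 <= t <= t1 -> t \notin [:: a; b; c] ->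
  caputo_defined t0 t1 al x t ->
  caputo_defined t0 t1 al y t /\
  caputo t0 t1 al y t = caputo t0 t1 al x t + (k * (kap * slope a b c m t)) *: r.
Proof.
move=> tI tabc cx; apply: caputo_unique => //.
apply: (diff_quotD tI caputo_primitive_varied cx).
exact: diff_quot_bump_variation.
Qed.

Let varied_eq (S : seq R) :
  (forall t, t0 <= t <= t1 -> t \notin S -> caputo_continuous_at t0 t1 al x t) ->
  forall s, t0 <= s <= t1 -> s \notin S -> s \notin [:: a; b; c] ->
  caputo t0 t1 al y s = caputo t0 t1 al x s + (k * (kap * slope a b c m s)) *: r.
Proof. by move=> HS s sI sS sabc; have [d _] := HS s sI sS; case: (caputo_varied sI sabc d). Qed.

Let one_sided_varied (S : seq R) (F : set_system R) (q : R) : ProperFilter F ->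
  (forall t, t0 <= t <= t1 -> t \notin S -> caputo_continuous_at t0 t1 al x t) ->
  (\forall s \near F, t0 <= s <= t1) -> (\forall s \near F, s \notin S) ->
  (\forall s \near F, s \notin [:: a; b; c]) ->
  (\forall s \near F, slope a b c m s = q) ->
  cvg (caputo t0 t1 al x s @[s --> F]) -> cvg (caputo t0 t1 al y s @[s --> F]).
Proof.
move=> FF HS H1 H2 H3 H4 /cvg_ex[l cl]; apply/cvg_ex; exists (l + (k * (kap * q)) *: r).
apply: (@cvg_trans _ (caputo t0 t1 al x s + (k * (kap * q)) *: r @[s --> F])).
  apply: near_eq_cvg; near=> s.
  have <- : slope a b c m s = q by near: s.
  by rewrite (varied_eq HS) //; near: s.
by apply: cvgD => //; exact: cvg_cst.
Unshelve. all: by end_near. Qed.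

Let abs_continuous_varied : abs_continuous t0 t1 (caputo_primitive t0 al y).
Proof.
have [_ acx _] := PCx; move=> e e0.
(* Two contributions, doubled by [enormD_le], must stay below [e]: the absolutely continuous part of
   [x] and the Lipschitz part of the bump get e/4 each. *)
have e40 : 0 < e / 4 by rewrite divr_gt0.
have [d1 d10 H1] := acx _ e40.
pose K := `|k| * (kap * 4) * enorm r.
have kap0 : 0 <= kap by apply: ltW; exact: caputo_cst_gt0.
have K0 : 0 <= K by rewrite !mulr_ge0 ?enorm_ge0.
have K10 : 0 < K + 1 by rewrite ltr_wpDl.
exists (Num.min d1 (e / 4 / (K + 1))); first by rewrite lt_min d10 divr_gt0.
move=> s sI sD; rewrite lt_min => /andP[L1 L2].
pose A := \sum_(p <- s) enorm (caputo_primitive t0 al x p.2 - caputo_primitive t0 al x p.1).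
have LA : A < e / 4 by exact: H1 s sI sD L1.
apply: (@le_lt_trans _ _ (2 * (A + K * \sum_(p <- s) (p.2 - p.1)))).
  rewrite mulr_sumr -big_split mulr_sumr /= big_seq [leRHS]big_seq.
  apply: ler_sum => p /(allP sI) /and3P[p1 p12 p2].
  rewrite !caputo_primitive_varied ?p1 ?p2 ?(le_trans p1 p12) ?(le_trans p12 p2) //.
  rewrite opprD addrACA; apply: le_trans (enormD_le _ _) _.
  rewrite ler_pM2l // lerD2l !caputo_primitive_bump_variation -scalerBl enormZ.
  rewrite /K mulrAC ler_wpM2r ?enorm_ge0 //.
  have -> : k * (kap * tent a b c m p.2) - k * (kap * tent a b c m p.1) =
    k * (kap * (tent a b c m p.2 - tent a b c m p.1)) by ring.
  rewrite !normrM (ger0_norm kap0) -!mulrA ler_wpM2l // ler_wpM2l //.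
  have := tent_lipschitz a b c p.2 p.1 m0 m1.
  by rewrite [`|p.2 - p.1|]ger0_norm // subr_ge0.
have : K * \sum_(p <- s) (p.2 - p.1) <= e / 4.
  apply: (@le_trans _ _ ((K + 1) * \sum_(p <- s) (p.2 - p.1))).
    rewrite ler_wpM2r ?lerDl //; rewrite big_seq; apply: sumr_ge0 => p /(allP sI) /and3P[_ p12 _].
    by rewrite subr_ge0.
  by rewrite mulrC -ler_pdivlMr // ltW.
by lra.
Qed.

(** The step function is locally constant off the nodes and has one-sided limits at them, so the
    perturbation only adds the three nodes to the exceptional set. *)
Lemma PC_varied (S : seq R) :
  (forall t, t \in S -> t0 < t < t1) ->
  (forall t, t0 <= t <= t1 -> t \notin S -> caputo_continuous_at t0 t1 al x t) ->
  (forall t, t \in S -> cvg (caputo t0 t1 al x s @[s --> t^'-]) /\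
                        cvg (caputo t0 t1 al x s @[s --> t^'+])) ->
  PC t0 t1 al y /\ forall t, t0 <= t <= t1 -> t \notin S ++ [:: a; b; c] ->
    caputo_continuous_at t0 t1 al y t /\
    caputo t0 t1 al y t = caputo t0 t1 al x t + (k * (kap * slope a b c m t)) *: r.
Proof.
move=> S1 S2 S3; have [cx _ _] := PCx.
have abcI t : t \in [:: a; b; c] -> t0 < t < t1.
  have t0b := lt_trans t0a ab; have t0c := lt_trans t0b bc.
  have bt1 := lt_trans bc ct1; have at1 := lt_trans ab bt1.
  by rewrite !inE => /or3P[] /eqP ->; apply/andP.
have cty t : t0 <= t <= t1 -> t \notin S ++ [:: a; b; c] -> caputo_continuous_at t0 t1 al y t.
  move=> tI tS'; have := tS'; rewrite mem_cat negb_or => /andP[tS tabc].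
  have [dx ctx] := S2 t tI tS.
  have [dy yE] := caputo_varied tI tabc dx.
  split; first exact: dy.
  rewrite yE.
  apply: (@cvg_trans _ (caputo t0 t1 al x s + (k * (kap * slope a b c m t)) *: r
      @[s --> within `[t0, t1] (nbhs t)])).
    apply: near_eq_cvg; near=> s.
    have sI : t0 <= s <= t1.
      near: s; rewrite near_withinE; apply: filterE => s /=; by rewrite in_itv.
    have : s \notin S ++ [:: a; b; c] by near: s; apply: cvg_within; exact: near_notin_nbhs.
    rewrite mem_cat negb_or => /andP[sS sabc].
    have <- : slope a b c m s = slope a b c m t.
      by near: s; apply: cvg_within; exact: near_slope.
    by rewrite (varied_eq S2).
  by apply: cvgD; [exact: ctx|exact: cvg_cst].
split; last first.
  move=> t tI tS'; split; first exact: cty.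
  move: tS'; rewrite mem_cat negb_or => /andP[tS tabc]; exact: varied_eq S2 _ _ _ _.
split; [|exact: abs_continuous_varied|].
  apply/subspace_continuousP => s sI; apply: cvgD.
    by apply/subspace_continuousP: s sI.
  by apply/subspace_continuousP: s sI; exact: bump_variation_continuous.
exists (S ++ [:: a; b; c]); split => //.
  by move=> t; rewrite mem_cat => /orP[/S1|/abcI].
move=> t tS'.
have tI : t0 < t < t1 by move: tS'; rewrite mem_cat => /orP[/S1|/abcI].
have /andP[t0t tt1] := tI.
(* A node outside [S] is a continuity point of the derivative of [x], hence both one-sided limits
   exist there too. *)
have [cl cr] : cvg (caputo t0 t1 al x s @[s --> t^'-]) /\
               cvg (caputo t0 t1 al x s @[s --> t^'+]).
  have [/S3//|tS] := boolP (t \in S).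
  have [|_ ct] := S2 t _ tS; first by rewrite !ltW.
  have {}ct := cvg_within_interior tI ct.
  by split; apply: cvgP; [exact: cvg_at_left_filter ct|exact: cvg_at_right_filter ct].
split.
- apply: (@one_sided_varied S _ ((a < t)%R%:R - (1 + m) * (b < t)%R%:R + m * (c < t)%R%:R) _ S2 _ _ _ _ cl).
  + near=> s; apply/andP; split; apply: ltW; first by near: s; exact: nbhs_left_gt.
    by apply: lt_trans tt1; near: s; exact: nbhs_left_lt.
  + by apply: near_left_dnbhs; exact: near_notin.
  + by apply: near_left_dnbhs; exact: near_notin.
  + near=> s; rewrite /slope; congr (_%:R - _ * _%:R + _ * _%:R); congr nat_of_bool;
    by near: s; exact: near_left_lt_eq.
- apply: (@one_sided_varied S _ ((a <= t)%R%:R - (1 + m) * (b <= t)%R%:R + m * (c <= t)%R%:R) _ S2 _ _ _ _ cr).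
  + near=> s; apply/andP; split; apply: ltW; last by near: s; exact: nbhs_right_lt.
    by apply: (lt_trans t0t); near: s; exact: nbhs_right_gt.
  + by apply: near_right_dnbhs; exact: near_notin.
  + by apply: near_right_dnbhs; exact: near_notin.
  + near=> s; rewrite /slope; congr (_%:R - _ * _%:R + _ * _%:R); congr nat_of_bool;
    by near: s; exact: near_right_lt_eq.
Unshelve. all: by end_near. Qed.

End caputo_calculus.

(** * Derivatives of the Lagrangian on the region of smoothness *)

Section c2_region.
Variables (R : realType) (n : nat) (t0 t1 : R).
Variables (L : R -> 'rV[R]_n -> 'rV[R]_n -> R).
Variable U : set (R * 'rV[R]_n * 'rV[R]_n).
Hypothesis oU : open U.
Let A : set (R * 'rV[R]_n * 'rV[R]_n) := U `&` [set p | t0 <= p.1.1 <= t1].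
Hypothesis C2 : C2_on A L.
Implicit Types (t s : R) (x y r : 'rV[R]_n).

Lemma cvg_triple (I : Type) (F : set_system I) (u : I -> R) (v w : I -> 'rV[R]_n) t x y :
  Filter F -> u i @[i --> F] --> t -> v i @[i --> F] --> x -> w i @[i --> F] --> y ->
  (u i, v i, w i) @[i --> F] --> (t, x, y).
Proof. by move=> FF cu cv cw; exact: (cvg_pair (cvg_pair cu cv) cw). Qed.

Lemma cvg_to_within (I : Type) (F : set_system I) (f : I -> R * 'rV[R]_n * 'rV[R]_n)
    (p : R * 'rV[R]_n * 'rV[R]_n) :
  Filter F -> f i @[i --> F] --> p -> (\forall i \near F, A (f i)) ->
  f i @[i --> F] --> within A (nbhs p).
Proof.
move=> FF cf HA P WP.
have NP : nbhs p (fun q => A q -> P q) by exact: WP.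
have H : \forall i \near F, A (f i) -> P (f i) by exact: (cf _ NP).
by apply: filterS2 HA H => i Ai; apply.
Qed.

Lemma section_near_x t x y : A (t, x, y) -> \forall z \near x, A (t, z, y).
Proof.
move=> [Up tI].
have cz : (t, z, y) @[z --> x] --> (t, x, y).
  exact: (cvg_triple (nbhs_filter x) (cvg_cst t) cvg_id (cvg_cst y)).
have : \forall z \near x, U (t, z, y) by apply: cz; exact: open_nbhs_nbhs.
by apply: filterS => z Uz; split.
Qed.

Lemma section_near_y t x y : A (t, x, y) -> \forall z \near y, A (t, x, z).
Proof.
move=> [Up tI].
have cz : (t, x, z) @[z --> y] --> (t, x, y).
  exact: (cvg_triple (nbhs_filter y) (cvg_cst t) (cvg_cst x) cvg_id).
have : \forall z \near y, U (t, x, z) by apply: cz; exact: open_nbhs_nbhs.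
by apply: filterS => z Uz; split.
Qed.

Lemma cvg_uncurry3 (T : topologicalType) (F : R -> 'rV[R]_n -> 'rV[R]_n -> T)
    (I : Type) (H : set_system I) (u : I -> R) (v w : I -> 'rV[R]_n) t x y :
  {within A, continuous (uncurry3 F)} -> Filter H -> A (t, x, y) ->
  u i @[i --> H] --> t -> v i @[i --> H] --> x -> w i @[i --> H] --> y ->
  (\forall i \near H, A (u i, v i, w i)) ->
  F (u i) (v i) (w i) @[i --> H] --> F t x y.
Proof.
move=> /subspace_continuousP cF FH Ap cu cv cw HA.
exact: (cvg_comp _ _ (cvg_to_within FH (cvg_triple FH cu cv cw) HA) (cF _ Ap)).
Qed.

Lemma section_continuous_x (T : topologicalType) (F : R -> 'rV[R]_n -> 'rV[R]_n -> T) t x y :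
  {within A, continuous (uncurry3 F)} -> A (t, x, y) ->
  {for x, continuous (fun z => F t z y)}.
Proof.
move=> cF Ap; exact: (cvg_uncurry3 cF (nbhs_filter x) Ap (cvg_cst t) cvg_id (cvg_cst y)
  (section_near_x Ap)).
Qed.

Lemma section_continuous_y (T : topologicalType) (F : R -> 'rV[R]_n -> 'rV[R]_n -> T) t x y :
  {within A, continuous (uncurry3 F)} -> A (t, x, y) ->
  {for y, continuous (fun z => F t x z)}.
Proof.
move=> cF Ap; exact: (cvg_uncurry3 cF (nbhs_filter y) Ap (cvg_cst t) (cvg_cst x) cvg_id
  (section_near_y Ap)).
Qed.

Let continuous_coord (G : 'rV[R]_n -> 'rV[R]_n) (f : 'rV[R]_n -> R) x :
  (forall z, G z = grad f z) -> {for x, continuous G} ->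
  forall i, {for x, continuous (fun z => 'D_(delta_mx 0 i) f z)}.
Proof.
move=> GE cG i; have -> : (fun z => 'D_(delta_mx 0 i) f z) = (fun M : 'rV[R]_n => M 0 i) \o G.
  by apply/funext => z /=; rewrite GE mxE.
by apply: continuous_comp => //; exact: coord_continuous.
Qed.

Lemma is_derive_Lx t x y r : A (t, x, y) ->
  is_derive x r (fun z => L t z y) (dotv (Lx L t x y) r).
Proof.
move=> Ap; have [hs [[_ cx _] _]] := C2; apply: is_derive_partials.
  apply: filterS (section_near_x Ap) => z /hs[h1 h2 h3 h4 h5]; exact: h1.
apply: (@continuous_coord (fun z => Lx L t z y)) => //.
exact: section_continuous_x.
Qed.

Lemma is_derive_Ly t x y r : A (t, x, y) ->
  is_derive y r (fun z => L t x z) (dotv (Ly L t x y) r).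
Proof.
move=> Ap; have [hs [[_ _ cy] _]] := C2; apply: is_derive_partials.
  apply: filterS (section_near_y Ap) => z /hs[h1 h2 h3 h4 h5]; exact: h2.
apply: (@continuous_coord (fun z => Ly L t x z)) => //.
exact: section_continuous_y.
Qed.

Lemma is_derive_Lxx t x y r : A (t, x, y) ->
  is_derive x r (fun z => dotv (Lx L t z y) r) (qform (Lxx L t x y) r).
Proof.
move=> Ap; have [hs [_ [cxx _ _]]] := C2; apply: is_derive_dotv_jac.
  apply: filterS (section_near_x Ap) => z /hs[h1 h2 h3 h4 h5]; exact: h3.
exact: (section_continuous_x cxx Ap).
Qed.

Lemma is_derive_Lxy t x y r : A (t, x, y) ->
  is_derive y r (fun z => dotv (Lx L t x z) r) (qform (Lxy L t x y) r).
Proof.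
move=> Ap; have [hs [_ [_ cxy _]]] := C2; apply: is_derive_dotv_jac.
  apply: filterS (section_near_y Ap) => z /hs[h1 h2 h3 h4 h5]; exact: h4.
exact: (section_continuous_y cxy Ap).
Qed.

Lemma is_derive_Lyy t x y r : A (t, x, y) ->
  is_derive y r (fun z => dotv (Ly L t x z) r) (qform (Lyy L t x y) r).
Proof.
move=> Ap; have [hs [_ [_ _ cyy]]] := C2; apply: is_derive_dotv_jac.
  apply: filterS (section_near_y Ap) => z /hs[h1 h2 h3 h4 h5]; exact: h5.
exact: (section_continuous_y cyy Ap).
Qed.

(* Expanding in [x] first and then in [y] at fixed [x] only differentiates [L_x] in
   [y]; nothing is assumed about [L_yx]. *)
Lemma lagrangian_second_difference_le t x y r (P Q C M : R) :
  (forall p q : R, `|p| <= `|P| -> `|q| <= `|Q| -> A (t, x + p *: r, y + q *: r)) ->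
  (forall p q : R, `|p| <= `|P| -> `|q| <= `|Q| ->
     `|qform (Lxx L t (x + p *: r) (y + q *: r)) r| <= C /\
     `|qform (Lxy L t (x + p *: r) (y + q *: r)) r| <= C) ->
  (forall q : R, `|q| <= `|Q| -> qform (Lyy L t x (y + q *: r)) r <= M) ->
  L t (x + P *: r) (y + Q *: r) + L t (x - P *: r) (y - Q *: r) - 2 * L t x y <=
    2 * C * P ^+ 2 + 2 * C * (`|P| * `|Q|) + M * Q ^+ 2.
Proof.
move=> HA HC HM.
have H0 (q : R) : `|q| <= `|Q| -> A (t, x, y + q *: r).
  by move=> qQ; have := HA 0 q; rewrite normr0 scale0r addr0; apply.
have := @second_difference2_le R
  (fun p q => L t (x + p *: r) (y + q *: r))
  (fun p q => dotv (Lx L t (x + p *: r) (y + q *: r)) r)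
  (fun p q => qform (Lxx L t (x + p *: r) (y + q *: r)) r)
  (fun q => qform (Lxy L t x (y + q *: r)) r)
  (fun q => dotv (Ly L t x (y + q *: r)) r)
  (fun q => qform (Lyy L t x (y + q *: r)) r) P Q C M.
rewrite /= !scaleNr !scale0r !addr0; apply.
- move=> p q pP qQ; apply: (@is_derive_line _ _ (fun z => L t z (y + q *: r)) x r).
  by apply: is_derive_Lx; exact: HA.
- move=> p q pP qQ; apply: (@is_derive_line _ _ (fun z => dotv (Lx L t z (y + q *: r)) r) x r).
  by apply: is_derive_Lxx; exact: HA.
- move=> q qQ; apply: (@is_derive_line _ _ (fun z => dotv (Lx L t x z) r) y r).
  by apply: is_derive_Lxy; exact: H0.
- move=> q qQ; apply: (@is_derive_line _ _ (fun z => L t x z) y r).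
  by apply: is_derive_Ly; exact: H0.
- move=> q qQ; apply: (@is_derive_line _ _ (fun z => dotv (Ly L t x z) r) y r).
  by apply: is_derive_Lyy; exact: H0.
- by move=> p q pP qQ; case: (HC p q pP qQ).
- move=> q qQ; have := HC 0 q; rewrite normr0 scale0r addr0.
  by move=> /(_ (normr_ge0 _) qQ) [].
- exact: HM.
Qed.

Lemma qform_continuous r : continuous (fun M : 'M[R]_n => qform M r).
Proof.
have -> : (fun M : 'M[R]_n => qform M r) =
    (fun M : 'M[R]_n => \sum_(i < n) \sum_(j < n) M i j * (r 0 j * r 0 i)).
  apply/funext => N; rewrite /qform /dotv; apply: eq_bigr => i _.
  by rewrite !mxE mulr_suml; apply: eq_bigr => j _; rewrite !mxE mulrA.
apply: continuous_big => [|i _]; first exact: add_continuous.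
apply: continuous_big => [|j _]; first exact: add_continuous.
move=> M; apply: (@continuousM R _ (fun M : 'M[R]_n => M i j) (cst (r 0 j * r 0 i))).
  exact: coord_continuous.
exact: cst_continuous.
Qed.

End c2_region.

(** * Uniform bounds along a curve with jumps *)

Section bounded_along_curve.
Variables (R : realType) (n : nat) (t0 t1 : R).
Variable U : set (R * 'rV[R]_n * 'rV[R]_n).
Hypothesis oU : open U.
Let A : set (R * 'rV[R]_n * 'rV[R]_n) := U `&` [set p | t0 <= p.1.1 <= t1].
Variables (I : finType) (f : I -> R * 'rV[R]_n * 'rV[R]_n -> R).
Hypothesis cf : forall i, {within A, continuous (f i)}.

Definition bounded_at (C : R) (p : R * 'rV[R]_n * 'rV[R]_n) : Prop :=
  U p /\ forall i, `|f i p| <= C.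

Lemma near_bounded_at (p : R * 'rV[R]_n * 'rV[R]_n) : A p ->
  exists C, \forall q \near p, t0 <= q.1.1 <= t1 -> bounded_at C q.
Proof.
move=> Ap.
have bd i : \forall q \near p, A q -> `|f i q| <= `|f i p| + 1.
  have /subspace_continuousP /(_ p Ap) ci : {within A, continuous (f i)} by exact: cf.
  have := cvgr_norm_le (f i p) ci (`|f i p| + 1).
  by rewrite ltrDl ltr01 near_withinE; apply.
have bdall : \forall q \near p, forall i, A q -> `|f i q| <= `|f i p| + 1.
  by apply: (@filter_forall _ _ _ (nbhs p) (nbhs_filter p)) => i; exact: bd.
have Up : \forall q \near p, U q by apply: open_nbhs_nbhs; case: Ap.
exists (\sum_i (`|f i p| + 1)); apply: filterS2 bdall Up => q bq Uq qI.
split=> // i; apply: le_trans (bq i _) _; first by split.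
by rewrite (bigD1 i) //= lerDl; apply: sumr_ge0 => j _; rewrite addr_ge0.
Qed.

Lemma bounded_at_le C C' p : C <= C' -> bounded_at C p -> bounded_at C' p.
Proof. by move=> CC' [h1 h2]; split=> // i; exact: le_trans CC'. Qed.

Variables (S : seq R) (x y : R -> 'rV[R]_n).
Implicit Types s t : R.

(** One parameter serves as the radius and, inverted, as the bound. The property is then inherited
    by smaller [d], so compactness can be applied along d -> 0+. *)
Definition bounded_around (d : R) (s : R) : Prop :=
  t0 <= s <= t1 -> s \notin S -> forall u v, ball (x s) d u -> ball (y s) d v ->
  bounded_at d^-1 (s, u, v).

Lemma bounded_around_le d e s : 0 < e -> e <= d -> bounded_around d s -> bounded_around e s.
Proof.
move=> e0 ed H sI sS u v bu bv; apply: (@bounded_at_le d^-1).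
  by rewrite lef_pV2 ?posrE // (lt_le_trans e0).
by apply: H => //; apply: le_ball ed _ _.
Qed.

(** The filter is abstract so as to cover the three cases: the relative neighborhood of a continuity
    point and the two sides of a jump, with [l] the corresponding limit. *)
Lemma near_bounded_around (F : set_system R) t (l : 'rV[R]_n) : Filter F ->
  A (t, x t, l) -> s @[s --> F] --> t -> x s @[s --> F] --> x t -> y s @[s --> F] --> l ->
  exists2 d, 0 < d & \forall s \near F, bounded_around d s.
Proof.
move=> FF Ap cs cx cy; have [C] := near_bounded_at Ap.
move=> /nbhs_ballP[d /= d0 Hd].
have d20 : 0 < d / 2 by rewrite divr_gt0.
(* The half radius is for the triangle inequality; the second entry makes 1/e at least |C| + 1. *)
pose e := Num.min (d / 2) (`|C| + 1)^-1.
have C10 : 0 < `|C| + 1 by rewrite ltr_wpDl.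
exists e; first by rewrite lt_min d20 invr_gt0.
have b1 : \forall s \near F, ball t d s by exact: cvg_ball cs _ d0.
have b2 : \forall s \near F, ball (x t) (d / 2) (x s) by exact: cvg_ball cx _ d20.
have b3 : \forall s \near F, ball l (d / 2) (y s) by exact: cvg_ball cy _ d20.
near=> s => sI sS u v bu bv.
apply: (@bounded_at_le C).
  apply: le_trans (ler_norm C) _; apply: (@le_trans _ _ (`|C| + 1)); first by rewrite lerDl.
  rewrite -[leLHS]invrK lef_pV2 ?posrE ?invr_gt0 //; last by rewrite lt_min d20 invr_gt0.
  by rewrite /e ge_min lexx orbT.
have ed : e <= d / 2 by rewrite /e ge_min lexx.
apply: Hd => //; split; [split|] => /=.
- by near: s.
- have -> : d = d / 2 + d / 2 by field.
  by apply: ball_triangle (le_ball ed bu); near: s.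
- have -> : d = d / 2 + d / 2 by field.
  by apply: ball_triangle (le_ball ed bv); near: s.
Unshelve. all: by end_near. Qed.

Hypothesis cx : {within `[t0, t1], continuous x}.
Hypothesis S1 : forall t, t \in S -> t0 < t < t1.
Hypothesis cy : forall t, t0 <= t <= t1 -> t \notin S ->
  A (t, x t, y t) /\ y s @[s --> within `[t0, t1] (nbhs t)] --> y t.
Hypothesis jump : forall t, t \in S -> exists l l',
  [/\ A (t, x t, l), A (t, x t, l'), y s @[s --> t^'-] --> l & y s @[s --> t^'+] --> l'].

(** Compactness is used on the interval and not on the graph, which need not be closed: each [t]
    gets its own radius, the smaller of the left and right ones at a jump. *)
Lemma uniformly_bounded_around :
  exists2 d, 0 < d & forall s, t0 <= s <= t1 -> bounded_around d s.
Proof.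
have loc t : t0 <= t <= t1 -> exists2 d, 0 < d & \forall s \near t, bounded_around d s.
  move=> tI; have cxt : x s @[s --> within `[t0, t1] (nbhs t)] --> x t.
    by apply/subspace_continuousP: t tI.
  have [tS|tS] := boolP (t \in S).
    have tI' := S1 tS; have ct := cvg_within_interior tI' cxt.
    have [l [l' [Al Al' cl cl']]] := jump tS.
    have [d d0 Hd] := near_bounded_around (at_left_proper_filter t) Al
      (cvg_at_left_filter cvg_id) (cvg_at_left_filter ct) cl.
    have [d' d'0 Hd'] := near_bounded_around (at_right_proper_filter t) Al'
      (cvg_at_right_filter cvg_id) (cvg_at_right_filter ct) cl'.
    exists (Num.min d d'); first by rewrite lt_min d0.
    move: Hd Hd'; rewrite /at_left /at_right !near_withinE => Hd Hd'.
    apply: filterS2 Hd Hd' => s Hs Hs' sI sS.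
    have [st|st|st] := ltgtP s t; last by move: sS; rewrite st tS.
      apply: (bounded_around_le _ _ (Hs st)) => //; first by rewrite lt_min d0.
      by rewrite ge_min lexx.
    apply: (bounded_around_le _ _ (Hs' st)) => //; first by rewrite lt_min d0.
    by rewrite ge_min lexx orbT.
  have [Al cl] := cy tI tS.
  have [d d0] := near_bounded_around (within_filter _ (nbhs_filter t)) Al
    (cvg_within_filter _ cvg_id) cxt cl.
  rewrite near_withinE => Hd; exists d => //.
  by apply: filterS Hd => s Hs sI; apply: Hs => //=; rewrite in_itv.
have /compact_near_coveringP/(_ R 0^'+ bounded_around _) := @segment_compact R t0 t1.
have H : forall s, `[t0, t1]%classic s -> \forall s' \near s & e \near 0^'+, bounded_around e s'.
  move=> t; rewrite /= in_itv /= => /loc[d d0 Hd].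
  exists ([set s | bounded_around d s], [set e | 0 < e /\ e <= d]) => /=.
    split => //; near=> e; split; first by near: e; exact: nbhs_right_gt.
    by near: e; exact: nbhs_right_le.
  by move=> [s e] /= [Hs [e0 ed]]; exact: bounded_around_le Hs.
move=> /(_ H) {}H.
have : \forall e \near 0^'+, 0 < e /\ `[t0, t1] `<=` bounded_around e.
  by near=> e; split; near: e => //; exact: nbhs_right_gt.
move=> /filter_ex[e [e0 He]]; exists e => // s sI.
Unshelve. all: by end_near. Qed.

End bounded_along_curve.

(** * Integrals off finitely many points *)

Section finite_exceptions.
Variable R : realType.
Notation mu := (@lebesgue_measure R).
Implicit Types (S : seq R) (A : set R) (f : R -> R).

Lemma setD_seq_cons (d : R) S A :
  A `\` [set s | s \in d :: S] = (A `\` [set s | s \in S]) `\ d.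
Proof.
apply/seteqP; split => s /=; rewrite inE.
  by move=> [As /negP]; rewrite negb_or => /andP[/eqP sd /negP sS].
by move=> [[As sS] sd]; split=> //; apply/negP; rewrite negb_or; apply/andP; split; [exact/eqP|exact/negP].
Qed.

Lemma measurable_setD_seq S A : measurable A -> measurable (A `\` [set s | s \in S]).
Proof.
move=> mA; elim: S => [|d S IH].
  by rewrite (_ : [set s | _] = set0) ?setD0 //; apply/seteqP; split.
by rewrite setD_seq_cons; exact: measurableD.
Qed.

(** Points are removed one at a time; a singleton is null, and measurability returns from the
    punctured set since every function is measurable on a singleton. *)
Lemma Rintegral_setD_seq S A f : measurable A ->
  measurable_fun (A `\` [set s | s \in S]) f ->
  \int[mu]_(s in A `\` [set s | s \in S]) f s = \int[mu]_(s in A) f s.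
Proof.
move=> mA; elim: S => [|d S IH].
  by rewrite (_ : [set s | _] = set0) ?setD0 //; apply/seteqP; split.
rewrite setD_seq_cons => mf.
have mB := measurable_setD_seq S mA.
have mBd : measurable ((A `\` [set s | s \in S]) `\ d) by exact: measurableD.
rewrite -IH; last first.
  have [Bd|Bd] := pselect ((A `\` [set s | s \in S]) d); last by rewrite -(not_setD1 Bd).
  rewrite -(setD1K Bd); apply/measurable_funU => //.
  by split => //; exact: measurable_fun_set1.
rewrite /Rintegral integral_setD1 //; exact/measurable_EFinP.
Qed.

End finite_exceptions.

(** * Singular weights and indicators *)

Section weights.
Variable R : realType.
Notation mu := (@lebesgue_measure R).

Lemma powR_bounds (q u v : R) : 0 < u -> u <= v ->
  exists W1 W2 : R, [/\ 0 < W1, 0 <= W2 & forall z, u <= z <= v -> W1 <= z `^ q <= W2].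
Proof.
move=> u0 uv; have v0 := lt_le_trans u0 uv.
have [q0|/ltW q0] := leP 0 q.
  exists (u `^ q), (v `^ q); split; rewrite ?powR_gt0 ?powR_ge0 // => z /andP[uz zv].
  have z0 := lt_le_trans u0 uz.
  by apply/andP; split; apply: ge0_ler_powR; rewrite ?nnegrE ?(ltW u0) ?(ltW v0) ?(ltW z0).
exists (v `^ q), (u `^ q); split; rewrite ?powR_gt0 ?powR_ge0 // => z /andP[uz zv].
have z0 := lt_le_trans u0 uz.
by apply/andP; split; apply: powR_le_anti.
Qed.

(** On each half of the interval one factor is bounded and the other integrable, so the product is
    dominated by a sum of two one-sided powers. *)
Lemma integrable_double_power (p q a b : R) : 0 < p -> 0 < q -> a < b ->
  mu.-integrable `[a, b] (EFin \o (fun t => (b - t) `^ (q - 1) * (t - a) `^ (p - 1))).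
Proof.
move=> p0 q0 ab; pose T := (a + b) / 2.
have aT : a < T by rewrite /T; lra.
have Tb : T < b by rewrite /T; lra.
have [W [K1 [_ K10 HK1]]] := @powR_bounds (q - 1) (b - T) (b - a) ltac:(lra) ltac:(lra).
have [W' [K2 [_ K20 HK2]]] := @powR_bounds (p - 1) (T - a) (b - a) ltac:(lra) ltac:(lra).
have i1 : mu.-integrable `[a, b] (EFin \o (fun t => K1 * (t - a) `^ (p - 1) + K2 * (b - t) `^ (q - 1))).
  apply: integrable_EFinD => //; apply: integrable_EFinZl => //.
    exact: integrable_powR_shift.
  exact: integrable_abel_kernel.
apply: le_integrable i1 => //.
- apply/measurable_EFinP; apply: measurable_funM; apply: measurable_funTS.
    apply: (@measurableT_comp _ _ _ _ _ _ (fun s => s `^ _)); first exact: measurable_powR.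
    exact: measurable_funB.
  apply: (@measurableT_comp _ _ _ _ _ _ (fun s => s `^ _)); first exact: measurable_powR.
  exact: measurable_funB.
- move=> t; rewrite /= in_itv /= => /andP[at_ tb]; rewrite lee_fin.
  rewrite !ger0_norm ?addr_ge0 ?mulr_ge0 ?powR_ge0 //.
  have [tT|/ltW tT] := leP t T.
    have /HK1/andP[_ w] : b - T <= b - t <= b - a by apply/andP; split; lra.
    by apply: ler_wpDr; rewrite ?mulr_ge0 ?powR_ge0 // ler_wpM2r ?powR_ge0.
  have /HK2/andP[_ w] : T - a <= t - a <= b - a by apply/andP; split; lra.
  by apply: ler_wpDl; rewrite ?mulr_ge0 ?powR_ge0 // mulrC ler_wpM2r ?powR_ge0.
Qed.

Lemma integrable_indic_finite (A B : set R) : measurable A -> measurable B ->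
  (mu A < +oo)%E -> mu.-integrable A (EFin \o (\1_B : R -> R)).
Proof.
move=> mA mB Afin; apply: measurable_bounded_integrable => //.
exists 1; split; rewrite ?num_real // => M M1 x _ /=.
rewrite indicE; case: (_ \in _); rewrite ?normr1 ?normr0 ?ltW //.
exact: lt_trans M1.
Qed.

Lemma Rintegral_indic_sub (A : set R) (u v : R) (bu bv : bool) : u < v -> measurable A ->
  [set` Interval (BSide bu u) (BSide bv v)] `<=` A ->
  \int[mu]_(t in A) \1_([set` Interval (BSide bu u) (BSide bv v)]) t = v - u.
Proof.
move=> uv mA sub; rewrite /Rintegral integral_indic // setIidl //.
have := lebesgue_measure_itv (Interval (BSide bu u) (BSide bv v)).
by rewrite /= lte_fin uv => ->.
Qed.

End weights.

(** * The Lagrangian near the optimal curve *)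

Section lagrangian_along_curve.
Variables (R : realType) (n : nat) (t0 t1 : R).
Variables (L : R -> 'rV[R]_n -> 'rV[R]_n -> R).
Variable U : set (R * 'rV[R]_n * 'rV[R]_n).
Hypothesis oU : open U.
Let A : set (R * 'rV[R]_n * 'rV[R]_n) := U `&` [set p | t0 <= p.1.1 <= t1].
Hypothesis C2 : C2_on A L.
Variables (S : seq R) (x y : R -> 'rV[R]_n) (r : 'rV[R]_n).
Hypothesis cx : {within `[t0, t1], continuous x}.
Hypothesis S1 : forall t, t \in S -> t0 < t < t1.
Hypothesis cy : forall t, t0 <= t <= t1 -> t \notin S ->
  A (t, x t, y t) /\ y s @[s --> within `[t0, t1] (nbhs t)] --> y t.
Hypothesis jump : forall t, t \in S -> exists l l',
  [/\ A (t, x t, l), A (t, x t, l'), y s @[s --> t^'-] --> l & y s @[s --> t^'+] --> l'].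
Notation mu := (@lebesgue_measure R).
Implicit Types s t : R.

(** The constants are uniform in [t] despite the jumps, and can be fixed before the parameters of
    the bump. *)
Lemma lagrangian_bounds : exists rho C : R, [/\ 0 < rho, 0 < C &
  forall t u v, t0 <= t <= t1 -> t \notin S -> ball (x t) rho u -> ball (y t) rho v ->
    [/\ A (t, u, v), `|L t u v| <= C, `|qform (Lxx L t u v) r| <= C,
        `|qform (Lxy L t u v) r| <= C & `|qform (Lyy L t u v) r| <= C]].
Proof.
have [_ [[cL _ _] [cxx cxy cyy]]] := C2.
have q (F : _ -> 'M[R]_n) : {within A, continuous F} ->
    {within A, continuous (fun p => qform (F p) r)}.
  move=> /subspace_continuousP c; apply/subspace_continuousP => p Ap.
  exact: (cvg_comp _ _ (c p Ap) (@qform_continuous _ _ r (F p))).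
pose fs : seq (R * 'rV[R]_n * 'rV[R]_n -> R) :=
  [:: uncurry3 L; (fun p => qform (uncurry3 (Lxx L) p) r);
      (fun p => qform (uncurry3 (Lxy L) p) r); (fun p => qform (uncurry3 (Lyy L) p) r)].
have cf (i : 'I_4) : {within A, continuous (nth (fun=> 0) fs i)}.
  case: i => -[|[|[|[|//]]]] _ /=; [exact: cL|exact: q|exact: q|exact: q].
have [d d0 Hd] := uniformly_bounded_around oU cf cx S1 cy jump.
exists d, d^-1; split; rewrite ?invr_gt0 // => t u v tI tS bu bv.
have [Up H] := Hd t tI tI tS u v bu bv.
split; first by split.
- exact: (H (@Ordinal 4 0 isT)).
- exact: (H (@Ordinal 4 1 isT)).
- exact: (H (@Ordinal 4 2 isT)).
- exact: (H (@Ordinal 4 3 isT)).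
Qed.

(** Only the last argument leaves the curve, as the second-difference bound demands; continuity of
    [y] at [tau] turns closeness to y t into closeness to y tau. *)
Lemma qform_Lyy_neg_near (tau : R) (c0 : R) : t0 < tau < t1 ->
  A (tau, x tau, y tau) -> y s @[s --> within `[t0, t1] (nbhs tau)] --> y tau ->
  qform (Lyy L tau (x tau) (y tau)) r < c0 ->
  exists2 eta : R, 0 < eta & forall t v, `|t - tau| < eta -> t0 <= t <= t1 ->
    ball (y t) eta v -> qform (Lyy L t (x t) v) r <= c0.
Proof.
move=> tauI Ap cyt q0.
have cxt : x s @[s --> within `[t0, t1] (nbhs tau)] --> x tau.
  have /subspace_continuousP cx' := cx.
  by apply: cx'; rewrite /= in_itv /=; case/andP: tauI => h1 h2; rewrite !ltW.
have {}cxt := cvg_within_interior tauI cxt.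
have {}cyt := cvg_within_interior tauI cyt.
have [_ [_ [_ _ /subspace_continuousP cyy]]] := C2.
pose p : R * 'rV[R]_n * 'rV[R]_n := (tau, x tau, y tau).
have c : qform (uncurry3 (Lyy L) q) r @[q --> within A (nbhs p)] --> qform (uncurry3 (Lyy L) p) r.
  exact: (cvg_comp _ _ (cyy p Ap) (@qform_continuous _ _ r _)).
have H1 : \forall q \near p, A q -> qform (uncurry3 (Lyy L) q) r < c0.
  have := cvgr_lt _ c _ q0; rewrite near_withinE; apply.
have H2 : \forall q \near p, U q by apply: open_nbhs_nbhs; case: Ap.
have : \forall q \near p, t0 <= q.1.1 <= t1 -> qform (uncurry3 (Lyy L) q) r <= c0.
  by apply: filterS2 H1 H2 => q Hq Uq qI; apply/ltW/Hq; split.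
move=> /nbhs_ballP[d /= d0 Hd].
have d20 : 0 < d / 2 by rewrite divr_gt0.
have b2 : \forall s \near tau, ball (x tau) d (x s) by exact: cvg_ball cxt _ d0.
have b3 : \forall s \near tau, ball (y tau) (d / 2) (y s) by exact: cvg_ball cyt _ d20.
have /nbhs_ballP[e /= e0 He] : \forall s \near tau, ball (x tau) d (x s) /\ ball (y tau) (d / 2) (y s).
  by apply: filterS2 b2 b3.
exists (Num.min e (d / 2)); first by rewrite lt_min e0.
move=> t v; rewrite lt_min => /andP[te td] tI bv.
have [bx by_] : ball (x tau) d (x t) /\ ball (y tau) (d / 2) (y t).
  by apply: He; rewrite -ball_normE /ball_ /= distrC.
apply: (Hd (t, x t, v)) => //; split; [split => //=|] => /=.
  by rewrite -ball_normE /ball_ /= distrC (lt_trans td) // ltr_pdivrMr // ltr_pMr // ltr1n.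
have -> : d = d / 2 + d / 2 by field.
apply: ball_triangle by_ _; apply: le_ball bv; by rewrite ge_min lexx orbT.
Qed.

(** The weight is integrable because be > 0; the other factor is bounded and, being continuous
    relative to [D], measurable. *)
Lemma integrable_lagrangian (be C : R) (D : set R) (u v : R -> 'rV[R]_n) :
  0 < be -> measurable D -> D `<=` `[t0, t1] ->
  (forall t, D t -> A (t, u t, v t)) ->
  (forall t, D t -> u s @[s --> within D (nbhs t)] --> u t) ->
  (forall t, D t -> v s @[s --> within D (nbhs t)] --> v t) ->
  (forall t, D t -> `|L t (u t) (v t)| <= C) ->
  mu.-integrable D (EFin \o (fun t => (t1 - t) `^ (be - 1) * L t (u t) (v t))).
Proof.
move=> be0 mD Dsub DA cu cv HC.
have [_ [[cL _ _] _]] := C2.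
have iw : mu.-integrable D (fun s => ((t1 - s) `^ (be - 1))%:E).
  by apply: integrableS (integrable_abel_kernel t0 t1 be0).
have cLt : {within D, continuous (fun t => L t (u t) (v t))}.
  apply/subspace_continuousP => t Dt.
  apply: (cvg_uncurry3 cL (within_filter _ (nbhs_filter t)) (DA t Dt) _ (cu t Dt) (cv t Dt)).
    exact: cvg_within.
  by rewrite near_withinE; apply: filterE => s; exact: DA.
have := @integrableMl _ _ _ mu D mD _ (fun t => L t (u t) (v t)) iw.
apply; first exact: subspace_continuous_measurable_fun.
exists C; split; rewrite ?num_real // => M CM t Dt /=.
by apply: le_trans (HC t Dt) _; exact: ltW.
Qed.

End lagrangian_along_curve.

(** * Size of the bump and choice of its parameters *)

Section bump_estimates.
Variables (R : realType) (al tau e m : R).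
Hypotheses (al0 : 0 < al) (al1 : al <= 1) (e0 : 0 < e) (m0 : 0 <= m) (m1 : m <= 1).
Notation a := (tau - 2 * e).
Notation b := (tau - e).

Let ab : a <= b. Proof. by move: e0; lra. Qed.
Let bc : b <= tau. Proof. by move: e0; lra. Qed.

(** A difference of two nonnegative increments, the second weighted by m in [0, 1]: any common bound
    of the increments bounds the absolute value of the bump. *)
Let bumpE t : bumpfun al a b tau m t =
  (pos_powR al a t - pos_powR al b t) - m * (pos_powR al b t - pos_powR al tau t).
Proof. by rewrite /bumpfun; ring. Qed.

Let bump_bound t K : 0 <= K -> pos_powR al a t - pos_powR al b t <= K ->
  pos_powR al b t - pos_powR al tau t <= K -> `|bumpfun al a b tau m t| <= K.
Proof.
move=> K0 h1 h2; rewrite bumpE ler_norml.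
have g1 := pos_powR_diff_ge0 t al0 ab; have g2 := pos_powR_diff_ge0 t al0 bc.
have g3 := mulr_ge0 m0 g2.
have g4 : m * (pos_powR al b t - pos_powR al tau t) <= K.
  by apply: le_trans (ler_piMl g2 m1) h2.
by apply/andP; split; lra.
Qed.

Lemma bump_le t : `|bumpfun al a b tau m t| <= e `^ al.
Proof.
have h1 := pos_powR_diff_le t al0 al1 ab; have h2 := pos_powR_diff_le t al0 al1 bc.
have E1 : b - a = e by ring. have E2 : tau - b = e by ring.
rewrite E1 in h1; rewrite E2 in h2.
by apply: bump_bound; [exact: powR_ge0|exact: h1|exact: h2].
Qed.

(** The tangent bound gives slopes (t-b)^(al-1) and (t-tau)^(al-1); the latter dominates because al
    - 1 <= 0. *)
Lemma bump_tail_le t : tau < t -> `|bumpfun al a b tau m t| <= e * (t - tau) `^ (al - 1).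
Proof.
move=> taut; have bt : b < t by apply: le_lt_trans taut.
have h1 := pos_powR_diff_le_tangent al0 al1 ab bt.
have h2 := pos_powR_diff_le_tangent al0 al1 bc taut.
have E1 : b - a = e by ring. have E2 : tau - b = e by ring.
rewrite E1 in h1; rewrite E2 in h2.
apply: bump_bound; [by rewrite mulr_ge0 ?powR_ge0 ?ltW| |exact: h2].
apply: le_trans h1 _; rewrite ler_pM2l //; apply: powR_le_anti.
- by rewrite subr_le0.
- by rewrite subr_gt0.
- by rewrite lerD2l lerN2.
Qed.

(* One factor is bounded by [bump_le], the other by [bump_tail_le]: the product is
   o(e) and stays integrable against [(t1 - t) `^ (be - 1)]. *)
Lemma bump_tail_sqr_le t : tau < t ->
  bumpfun al a b tau m t ^+ 2 <= e `^ al * e * (t - tau) `^ (al - 1).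
Proof.
move=> taut; rewrite -(real_normK (num_real _)) expr2 -mulrA.
by apply: ler_pM => //; [exact: bump_le|exact: bump_tail_le].
Qed.

Lemma bump_left t : t <= a -> bumpfun al a b tau m t = 0.
Proof.
move=> ta; have tb := le_trans ta ab; have tt := le_trans tb bc.
by rewrite /bumpfun !pos_powR_le0 // !mulr0 subr0 addr0.
Qed.

Lemma slope_left t : t <= a -> slope a b tau m t = 0.
Proof.
move=> ta; have tb := le_trans ta ab; have tt := le_trans tb bc.
by rewrite /slope !ltNge ta tb tt /= !mulr0 subr0 addr0.
Qed.

Lemma slope_mid1 t : a < t -> t <= b -> slope a b tau m t = 1.
Proof.
move=> ta tb; have tt := le_trans tb bc.
by rewrite /slope ta !ltNge tb tt /= !mulr0 subr0 addr0.
Qed.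

Lemma slope_mid2 t : b < t -> t <= tau -> slope a b tau m t = - m.
Proof.
move=> tb tt; have ta := le_lt_trans ab tb.
by rewrite /slope ta tb ltNge tt /= mulr0 mulr1 addr0; ring.
Qed.

Lemma slope_right t : tau < t -> slope a b tau m t = 0.
Proof.
move=> tt; have tb := le_lt_trans bc tt; have ta := le_lt_trans ab tb.
by rewrite /slope ta tb tt /= !mulr1; ring.
Qed.

End bump_estimates.

(** The value at [t1] is N - m D, where N and D are consecutive increments of s^al beyond t1 - tau.
    Monotonicity makes both positive and concavity gives N <= D. *)
Lemma bump_coef (R : realType) (al tau e t1 : R) : 0 < al -> al <= 1 -> 0 < e -> tau < t1 ->
  exists m, [/\ 0 <= m, m <= 1 & bumpfun al (tau - 2 * e) (tau - e) tau m t1 = 0].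
Proof.
move=> al0 al1 e0 taut1; pose d := t1 - tau; have d0 : 0 < d by rewrite subr_gt0.
pose N := (d + 2 * e) `^ al - (d + e) `^ al; pose D := (d + e) `^ al - d `^ al.
have mono u v : 0 < u -> u < v -> u `^ al < v `^ al.
  by move=> u0 uv; apply: gt0_ltr_powR; rewrite ?nnegrE ?ltW // (lt_trans u0).
have D0 : 0 < D by rewrite subr_gt0; apply: mono => //; rewrite ltrDl.
have N0 : 0 < N by rewrite subr_gt0; apply: mono; lra.
exists (N / D); split.
- by rewrite divr_ge0 // ltW.
- by rewrite ler_pdivrMr // mul1r; exact: powR_second_diff_le.
rewrite /bumpfun !pos_powR_ge; [|lra|lra|lra].
have -> : t1 - (tau - 2 * e) = d + 2 * e by rewrite /d; ring.
have -> : t1 - (tau - e) = d + e by rewrite /d; ring.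
rewrite -/d.
have -> : (d + 2 * e) `^ al = N + (d + e) `^ al by rewrite /N; ring.
have -> : d `^ al = (d + e) `^ al - D by rewrite /D; ring.
by field; exact: lt0r_neq0.
Qed.

Lemma small_powR (R : realType) (al K c u : R) : 0 < al -> 0 < K -> 0 < c -> 0 < u ->
  exists e, [/\ 0 < e, e <= u & e `^ al * K < c].
Proof.
(* Chosen so that z^al K = c/2. *)
move=> al0 K0 c0 u0; pose z := (c / (2 * K)) `^ al^-1.
have z0 : 0 < z by rewrite powR_gt0 // divr_gt0 // mulr_gt0.
exists (Num.min u z); split; rewrite ?lt_min ?u0 // ?ge_min ?lexx //.
apply: (@le_lt_trans _ _ (z `^ al * K)).
  rewrite ler_pM2r //; apply: ge0_ler_powR; rewrite ?nnegrE ?(ltW al0) ?(ltW z0) //.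
    by rewrite le_min !ltW.
  by rewrite ge_min lexx orbT.
rewrite -powRrM mulVf ?lt0r_neq0 // powRr1; last by rewrite divr_ge0 ?mulr_ge0 ?ltW.
have -> : c / (2 * K) * K = c / 2 by field; exact: lt0r_neq0.
by rewrite ltr_pdivrMr // ltr_pMr // ltr1n.
Qed.

(** * Integration of the pointwise bound *)

Section comparison.
Variables (R : realType) (t0 t1 al be tau : R).
Hypotheses (al0 : 0 < al) (be0 : 0 < be) (t0tau : t0 < tau) (taut1 : tau < t1).
Notation mu := (@lebesgue_measure R).

(** The part of the tail bound that depends on neither [e] nor [lam], extended by 0 so that it can
    be added to the indicators on [t0, t1]. *)
Definition tail_weight : R -> R :=
  (fun t => (t1 - t) `^ (be - 1) * (t - tau) `^ (al - 1)) \_ `[tau, t1].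

Definition tail_mass : R := \int[mu]_(t in `[t0, t1]) tail_weight t.

Lemma tail_mass_ge0 : 0 <= tail_mass.
Proof.
apply: Rintegral_ge0 => t _; rewrite /tail_weight patchE; case: ifP => // _.
by rewrite mulr_ge0 ?powR_ge0.
Qed.

Lemma tail_weightE t : tau < t -> t <= t1 ->
  tail_weight t = (t1 - t) `^ (be - 1) * (t - tau) `^ (al - 1).
Proof.
move=> taut tt1; rewrite /tail_weight patchE ifT //.
by apply/mem_set; rewrite /= in_itv /= tt1 ltW.
Qed.

Lemma tail_weight0 t : t < tau -> tail_weight t = 0.
Proof.
move=> ttau; rewrite /tail_weight patchE ifF //; apply/negbTE/negP => /set_mem.
by rewrite /= in_itv /= leNgt ttau.
Qed.

Lemma integrable_tail_weight : mu.-integrable `[t0, t1] (EFin \o tail_weight).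
Proof.
rewrite /tail_weight -restrict_EFin; apply/integrable_restrict => //.
rewrite (_ : `[t0, t1] `&` `[tau, t1] = `[tau, t1]%classic); last first.
  apply/seteqP; split => t /=; rewrite !in_itv /=; first by case.
  by move=> /andP[h1 h2]; rewrite h1 h2 (le_trans (ltW t0tau) h1).
exact: integrable_double_power.
Qed.

(** The pointwise bound is known only off a finite set, whereas the functionals integrate over the
    whole interval; all integrals are first moved to [D]. *)
Lemma second_difference_integral_le (S : seq R) (fp fm f0 : R -> R) (a b l2 Ka Kb Kc : R) :
  t0 <= a -> a < b -> b < tau -> 0 <= l2 ->
  let D := `[t0, t1] `\` [set s | s \in S] in
  mu.-integrable D (EFin \o fp) -> mu.-integrable D (EFin \o fm) ->
  mu.-integrable D (EFin \o f0) ->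
  (forall t, D t -> fp t + fm t - 2 * f0 t <=
    l2 * (Ka * \1_(`[a, tau]%classic) t - Kb * \1_(`]a, b[%classic) t + Kc * tail_weight t)) ->
  \int[mu]_(t in `[t0, t1]) fp t + \int[mu]_(t in `[t0, t1]) fm t -
    2 * \int[mu]_(t in `[t0, t1]) f0 t <=
  l2 * (Ka * (tau - a) - Kb * (b - a) + Kc * tail_mass).
Proof.
move=> t0a ab btau l20 D ip im i0 H.
have mI : measurable `[t0, t1]%classic by exact: measurable_itv.
have mD : measurable D by exact: measurable_setD_seq.
have bt1 := lt_trans btau taut1.
have fin : (mu `[t0, t1] < +oo)%E.
  by rewrite lebesgue_measure_itv /=; case: ifP => // _; rewrite -EFinD ltry.
pose psi t := Ka * \1_(`[a, tau]%classic) t + (- Kb * \1_(`]a, b[%classic) t + Kc * tail_weight t).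
have i1 : mu.-integrable `[t0, t1] (EFin \o (\1_(`[a, tau]%classic) : R -> R)).
  exact: integrable_indic_finite.
have i2 : mu.-integrable `[t0, t1] (EFin \o (\1_(`]a, b[%classic) : R -> R)).
  exact: integrable_indic_finite.
have i3 := integrable_tail_weight.
have i23 : mu.-integrable `[t0, t1] (EFin \o (fun t => - Kb * \1_(`]a, b[%classic) t + Kc * tail_weight t)).
  by apply: integrable_EFinD => //; apply: integrable_EFinZl.
have ipsi : mu.-integrable `[t0, t1] (EFin \o psi).
  by apply: integrable_EFinD => //; apply: integrable_EFinZl.
have Ipsi : \int[mu]_(t in `[t0, t1]) psi t = Ka * (tau - a) - Kb * (b - a) + Kc * tail_mass.
  rewrite RintegralD //; last exact: integrable_EFinZl.
  rewrite RintegralD //; [|exact: integrable_EFinZl|exact: integrable_EFinZl].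
  rewrite !RintegralZl // !Rintegral_indic_sub //; [by rewrite /tail_mass; ring| | |].
  - by move=> t /=; rewrite !in_itv /= => /andP[h1 h2]; have h3 := taut1;
      apply/andP; split; lra.
  - exact: lt_trans ab btau.
  - by move=> t /=; rewrite !in_itv /= => /andP[h1 h2]; have h3 := taut1;
      apply/andP; split; lra.
have sub : D `<=` `[t0, t1] by move=> t [].
have ipsiD : mu.-integrable D (EFin \o psi) by apply: integrableS ipsi.
have toD f : mu.-integrable D (EFin \o f) ->
    \int[mu]_(t in `[t0, t1]) f t = \int[mu]_(t in D) f t.
  move=> fi; apply/esym; apply: Rintegral_setD_seq => //.
  by apply/measurable_EFinP; case/integrableP: fi.
rewrite -Ipsi !toD //.
rewrite -RintegralZl // -RintegralD // -RintegralZl // -RintegralB //; last 2 first.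
- exact: integrable_EFinD.
- exact: integrable_EFinZl.
apply: le_Rintegral => //.
- have := integrable_EFinD mD (integrable_EFinD mD ip im) (integrable_EFinZl (-2) mD i0).
  by under eq_fun do rewrite mulNr.
- exact: integrable_EFinZl.
move=> t Dt; apply: le_trans (H t Dt) _; rewrite /psi; lra.
Qed.

End comparison.

(** * The contradiction with minimality *)

Lemma cvg_within_sub (R : realType) (T : topologicalType) (f : R -> T) (D E : set R) (t : R) (l : T) :
  D `<=` E -> f s @[s --> within E (nbhs t)] --> l -> f s @[s --> within D (nbhs t)] --> l.
Proof.
move=> DE H P NP.
have : \forall s \near within E (nbhs t), P (f s) by exact: (H P NP).
rewrite near_withinE => HE.
have : \forall s \near within D (nbhs t), P (f s).
  by rewrite near_withinE; apply: filterS HE => s h /DE /h.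
exact.
Qed.

Lemma ball_addZ (R : realType) (n : nat) (x r : 'rV[R]_n) (p rho : R) :
  `|p| * `|r| < rho -> ball x rho (x + p *: r).
Proof.
by move=> h; rewrite -ball_normE /ball_ /= opprD addrA subrr add0r normrN normrZ.
Qed.

Local Opaque caputo caputo_primitive Lx Ly Lxx Lxy Lyy.

Theorem theorem4p2 (R : realType) (n : nat) (t0 t1 : R) (xa xb : 'rV[R]_n)
    (al be : R) (L : R -> 'rV[R]_n -> 'rV[R]_n -> R) (x0 : R -> 'rV[R]_n) :
  t0 < t1 -> 0 < al <= 1 -> 0 < be ->
  weak_local_min t0 t1 xa xb al be L x0 ->
  C2_near_graph t0 t1 al L x0 ->
  let P := fun t => Lyy L t (x0 t) (caputo t0 t1 al x0 t) in
  forall t : R, t0 < t < t1 -> caputo_continuous_at t0 t1 al x0 t ->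
  forall r : 'rV[R]_n, 0 <= dotv (P t *m r^T)^T r.
Proof.
move=> t01 /andP[al0 al1] be0 [[PCx xa0 xb1] [delta delta0 Hmin]] [U [oU GU C2]].
move=> P tau tauI [dtau cvtau] r; rewrite leNgt; apply/negP => Pneg.
have diff_ge0 (u v w : R) : w <= u -> w <= v -> 0 <= u + v - 2 * w by lra.
have [cx _ [S [S1 S2 S3]]] := PCx.
have [taul taur] := andP tauI.
have tauI' : t0 <= tau <= t1 by rewrite !ltW.
pose y := caputo t0 t1 al x0.
pose A : set (R * 'rV[R]_n * 'rV[R]_n) := U `&` [set p | t0 <= p.1.1 <= t1].
have gA t l : t0 <= t <= t1 -> caputo_graph t0 t1 al x0 (t, x0 t, l) -> A (t, x0 t, l).
  by move=> tI g; split; [exact: GU|].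
have cy t : t0 <= t <= t1 -> t \notin S ->
    A (t, x0 t, y t) /\ y s @[s --> within `[t0, t1] (nbhs t)] --> y t.
  move=> tI tS; have [dt ct] := S2 t tI tS; split; last exact: ct.
  by apply: gA => //; split => //; left; split; [exact: dt|].
have jump t : t \in S -> exists l l', [/\ A (t, x0 t, l), A (t, x0 t, l'),
    y s @[s --> t^'-] --> l & y s @[s --> t^'+] --> l'].
  move=> tS; have tI := S1 t tS.
  have tI' : t0 <= t <= t1 by case/andP: tI => h1 h2; rewrite !ltW.
  have [/cvg_ex[l cl] /cvg_ex[l' cl']] := S3 t tS.
  exists l, l'; split; [| |exact: cl|exact: cl'].
    by apply: gA => //; split => //; right; split => //; left; exact: cl.
  by apply: gA => //; split => //; right; split => //; right; exact: cl'.
have Atau : A (tau, x0 tau, y tau).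
  by apply: gA => //; split => //; left; split; [exact: dtau|].
have [rho [C [rho0 C0 HB]]] := lagrangian_bounds oU C2 r cx S1 cy jump.
pose q0 := qform (Lyy L tau (x0 tau) (y tau)) r.
have q00 : q0 < 0 by exact: Pneg.
(* Half of the negative value is kept; the other half is the margin for continuity near [tau]. *)
pose c0 : R := - q0 / 2.
have c00 : 0 < c0 by rewrite /c0; lra.
have q0c0 : q0 < - c0 by rewrite /c0; lra.
have [eta eta0 Heta] := qform_Lyy_neg_near oU C2 cx tauI Atau cvtau q0c0.
(* Bounds for the weight on all of [t0, tau], so that they do not depend on [e]. *)
have [W1 [W2 [W10 W20 HW]]] := @powR_bounds R (be - 1) (t1 - tau) (t1 - t0)
  ltac:(lra) ltac:(lra).
pose kap := caputo_cst al.
have kap0 : 0 < kap by exact: caputo_cst_gt0.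
pose I0 := tail_mass t0 t1 al be tau.
have I00 : 0 <= I0 by exact: tail_mass_ge0.
(* All errors divided by e^(1+al): the first term is the cost on [a, tau], of length 2e, the second
   that of the tail. The final 1 ensures K > 0. *)
pose K := 4 * C * W2 * (1 + kap) + 2 * C * I0 + 1.
have K0 : 0 < K.
  have C0' := ltW C0;
  have kap1 : 0 <= 1 + kap by rewrite addr_ge0 // ltW.
  by rewrite ltr_wpDl // addr_ge0 // !mulr_ge0.
pose Kb : R := c0 * kap ^+ 2 * W1.
have Kb0 : 0 < Kb by exact: mulr_gt0 (mulr_gt0 c00 (exprn_gt0 2 kap0)) W10.
(* The three caps give e^al <= 1, place [a, tau] in the neighborhood where the quadratic form is
   negative, and keep [a] above [t0]. *)
pose ub := Num.min 1 (Num.min (eta / 4) ((tau - t0) / 4)).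
have ub0 : 0 < ub by rewrite !lt_min ltr01 !divr_gt0 // subr_gt0.
have [e [e0 eub eK]] := small_powR al0 K0 Kb0 ub0.
have [e1 eeta et0] : [/\ e <= 1, 2 * e < eta & t0 < tau - 2 * e].
  by move: eub; rewrite !le_min => /and3P[h1 h2 h3]; split; lra.
have [m [m0 m1 bt1]] := bump_coef al0 al1 e0 taur.
pose a := tau - 2 * e; pose b := tau - e.
have ab : a < b by rewrite /a /b; lra.
have btau : b < tau by rewrite /b; lra.
pose E := e `^ al.
have E0 : 0 < E by exact: powR_gt0.
have E1 : E <= 1.
  have <- : 1 `^ al = 1 :> R by rewrite powR1.
  by apply: ge0_ler_powR; rewrite ?nnegrE ?(ltW al0) ?(ltW e0).
(* Per unit of [lam], [Z1] bounds the weak norm of the variation and [Z2] its displacement in the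
   max norm used by balls; [lam] is then chosen against delta, rho and eta. *)
pose Z1 := (E + kap * 4) * enorm r; pose Z2 := (E + kap) * `|r|.
have Z10 : 0 <= Z1 by rewrite mulr_ge0 ?enorm_ge0 // addr_ge0 ?mulr_ge0 ?ltW.
have Z20 : 0 <= Z2 by rewrite mulr_ge0 // addr_ge0 ?ltW.
pose lam := Num.min (delta / (Z1 + 1)) (Num.min rho eta / (Z2 + 1)).
have Z11 : 0 < Z1 + 1 by rewrite ltr_wpDl.
have Z21 : 0 < Z2 + 1 by rewrite ltr_wpDl.
have re0 : 0 < Num.min rho eta by rewrite lt_min rho0.
have lam0 : 0 < lam by rewrite lt_min !divr_gt0.
have lamZ1 : lam * Z1 < delta.
  have : lam * (Z1 + 1) <= delta by rewrite -ler_pdivlMr // ge_min lexx.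
  by rewrite mulrDr mulr1; lra.
have lamZ2 : lam * Z2 < Num.min rho eta.
  have : lam * (Z2 + 1) <= Num.min rho eta by rewrite -ler_pdivlMr // ge_min lexx orbT.
  by rewrite mulrDr mulr1; lra.
have [lamZ2r lamZ2e] : lam * Z2 < rho /\ lam * Z2 < eta.
  by move: lamZ2; rewrite lt_min => /andP[].
pose g := bumpfun al a b tau m; pose sl := slope a b tau m.
have gE t : `|g t| <= E by exact: bump_le.
have sl1 t : `|sl t| <= 1.
  have [ta|ta] := leP t a; first by rewrite /sl (slope_left m e0 ta) normr0.
  have [tb|tb] := leP t b; first by rewrite /sl (slope_mid1 m e0 ta tb) normr1.
  have [tt|tt] := leP t tau; last by rewrite /sl (slope_right m e0 tt) normr0.
  by rewrite /sl (slope_mid2 m e0 tb tt) normrN ger0_norm.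
pose S' := S ++ [:: a; b; tau].
pose D : set R := `[t0, t1] `\` [set s | s \in S'].
have mI : measurable (`[t0, t1]%classic : set R) by exact: measurable_itv.
have mD : measurable D by exact: measurable_setD_seq.
have Dsub : D `<=` `[t0, t1] by move=> t [].
have DI t : D t -> t0 <= t <= t1 by move=> /Dsub; rewrite /= in_itv.
have DS' t : D t -> t \notin S' by move=> [_ /negP].
have DS t : D t -> t \notin S by move=> /DS'; rewrite mem_cat negb_or => /andP[].
pose z (k s : R) := x0 s + bump_variation al a b tau m k r s.
have ballx (p : R) t : `|p| <= lam * `|g t| -> ball (x0 t) rho (x0 t + p *: r).
  move=> pg; apply: ball_addZ; apply: le_lt_trans lamZ2r.
  rewrite /Z2 mulrA ler_wpM2r //; apply: le_trans pg _; rewrite ler_pM2l //.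
  by apply: le_trans (gE t) _; rewrite lerDl ltW.
have bally (q d : R) t : lam * Z2 < d -> `|q| <= lam * (kap * `|sl t|) ->
    ball (y t) d (y t + q *: r).
  move=> hd qs; apply: ball_addZ; apply: le_lt_trans hd.
  rewrite /Z2 mulrA ler_wpM2r //; apply: le_trans qs _; rewrite ler_pM2l //.
  by apply: (@le_trans _ _ kap); [rewrite ler_piMr // ltW|rewrite lerDr ltW].
have zE k t : z k t = x0 t + (k * g t) *: r by [].
(* Stated for |k| = lam so that it serves both perturbations, k = lam and k = -lam. *)
have vary k : `|k| = lam ->
    [/\ functional t0 t1 al be L (z k) >= functional t0 t1 al be L x0,
        forall t, D t -> caputo t0 t1 al (z k) t = y t + (k * (kap * sl t)) *: r &
        (@lebesgue_measure R).-integrable D (EFin \o (fun t =>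
          (t1 - t) `^ (be - 1) * L t (z k t) (caputo t0 t1 al (z k) t)))].
  move=> kl.
  have [PCz Hz] := PC_varied t01 al0 al1 k r et0 ab btau taur m0 m1 PCx S1 S2 S3.
  have cE t : D t -> caputo t0 t1 al (z k) t = y t + (k * (kap * sl t)) *: r.
    by move=> Dt; have [_ ->] := Hz t (DI t Dt) (DS' t Dt).
  split; [|exact: cE|].
    apply: Hmin.
      split; first exact: PCz.
        rewrite /z /bump_variation (bump_left m al0 e0 (ltW et0)).
        by rewrite mulr0 scale0r addr0.
      by rewrite /z /bump_variation bt1 mulr0 scale0r addr0.
    have -> : (fun t => z k t - x0 t) = bump_variation al a b tau m k r.
      by apply/funext => t; rewrite /z addrC addKr.
    have := weak_norm_bump_variation t01 al0 al1 k r et0 ab btau m0 m1 (fun t _ => gE t).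
    move=> /le_lt_trans; apply; rewrite lte_fin kl -mulrA; exact: lamZ1.
  have nrm t : `|k * g t| <= lam * `|g t| by rewrite normrM kl.
  have nrm' t : `|k * (kap * sl t)| <= lam * (kap * `|sl t|).
    by rewrite !normrM kl (ger0_norm (ltW kap0)).
  have HBz t : D t -> A (t, z k t, caputo t0 t1 al (z k) t) /\
      `|L t (z k t) (caputo t0 t1 al (z k) t)| <= C.
    move=> Dt; rewrite cE // zE.
    have [h1 h2 _ _ _] := HB t _ _ (DI t Dt) (DS t Dt) (ballx _ t (nrm t))
      (bally _ _ t lamZ2r (nrm' t)).
    by split.
  apply: (integrable_lagrangian (C := C) C2 be0 mD Dsub).
  - by move=> t /HBz[].
  - move=> t Dt; apply: (cvg_within_sub Dsub).
    by have [/subspace_continuousP cz _ _] := PCz; apply: cz; exact: Dsub.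
  - move=> t Dt; apply: (cvg_within_sub Dsub).
    by have [[_ c] _] := Hz t (DI t Dt) (DS' t Dt); exact: c.
  - by move=> t /HBz[].
have lamn : `|lam| = lam by rewrite ger0_norm // ltW.
have lamn' : `|- lam| = lam by rewrite normrN.
have [Jp cp ip] := vary lam lamn; have [Jm cm im] := vary (- lam) lamn'.
have i0 : (@lebesgue_measure R).-integrable D (EFin \o (fun t =>
    (t1 - t) `^ (be - 1) * L t (x0 t) (y t))).
  apply: (integrable_lagrangian (C := C) C2 be0 mD Dsub).
  - by move=> t Dt; have [] := cy t (DI t Dt) (DS t Dt).
  - move=> t Dt; apply: (cvg_within_sub Dsub).
    by have /subspace_continuousP cz := cx; apply: cz; exact: Dsub.
  - move=> t Dt; apply: (cvg_within_sub Dsub).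
    by have [_ c] := cy t (DI t Dt) (DS t Dt); exact: c.
  - move=> t Dt; have [_ h _ _ _] := HB t (x0 t) (y t) (DI t Dt) (DS t Dt)
      (ballxx _ rho0) (ballxx _ rho0); exact: h.
pose Ka := W2 * (2 * C * E * (1 + kap)); pose Kc := 2 * C * (E * e).
have final := @second_difference_integral_le R t0 t1 al be tau al0 be0 taul taur S'
  _ _ _ a b (lam ^+ 2) Ka Kb Kc (ltW et0) ab btau (sqr_ge0 lam) ip im i0.
(* Since tau - a = 2e and b - a = e, the bracket is e (E (K - 1) - Kb), negative by the choice of
   [e]. *)
have key : lam ^+ 2 * (Ka * (tau - a) - Kb * (b - a) + Kc * I0) < 0.
  have -> : Ka * (tau - a) - Kb * (b - a) + Kc * I0 = e * (E * (K - 1) - Kb).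
    by rewrite /Ka /Kc /K /a /b; ring.
  rewrite pmulr_rlt0 ?exprn_gt0 // pmulr_rlt0 // subr_lt0.
  by apply: lt_trans eK; rewrite ltr_pM2l // gtrBl.
move: key; apply/negP; rewrite -leNgt.
apply: (le_trans (diff_ge0 _ _ _ Jp Jm)); apply: final.
move=> t Dt; rewrite cp // cm // !zE !mulNr !scaleNr.
have [tI tS tS'] := And3 (DI t Dt) (DS t Dt) (DS' t Dt).
pose w := (t1 - t) `^ (be - 1); have w0 : 0 <= w by exact: powR_ge0.
pose X := lam * g t; pose Y := lam * (kap * sl t).
rewrite -/w -/X -/Y.
pose Del := L t (x0 t + X *: r) (y t + Y *: r) + L t (x0 t - X *: r) (y t - Y *: r) -
  2 * L t (x0 t) (y t).
have -> : w * L t (x0 t + X *: r) (y t + Y *: r) + w * L t (x0 t - X *: r) (y t - Y *: r) -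
  2 * (w * L t (x0 t) (y t)) = w * Del by rewrite /Del; ring.
have XE : `|X| = lam * `|g t| by rewrite /X normrM lamn.
have YE : `|Y| = lam * (kap * `|sl t|) by rewrite /Y !normrM lamn (ger0_norm (ltW kap0)).
(* Used twice: with M = C at every point, and with M = - c0 near [tau]. *)
have DelM M : (forall q : R, `|q| <= `|Y| -> qform (Lyy L t (x0 t) (y t + q *: r)) r <= M) ->
    Del <= 2 * C * X ^+ 2 + 2 * C * (`|X| * `|Y|) + M * Y ^+ 2.
  move=> HM; apply: (lagrangian_second_difference_le oU C2).
  - move=> p q; rewrite XE YE => pX qY.
    by have [] := HB t _ _ tI tS (ballx _ t pX) (bally _ _ t lamZ2r qY).
  - move=> p q; rewrite XE YE => pX qY.
    by have [] := HB t _ _ tI tS (ballx _ t pX) (bally _ _ t lamZ2r qY).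
  - exact: HM.
have DelC : Del <= 2 * C * X ^+ 2 + 2 * C * (`|X| * `|Y|) + C * Y ^+ 2.
  apply: DelM => q; rewrite YE => qY.
  have bx : ball (x0 t) rho (x0 t) by exact: ballxx.
  have [_ _ _ _ h] := HB t _ _ tI tS bx (bally _ _ t lamZ2r qY).
  exact: le_trans (ler_norm _) h.
have Delneg : `|t - tau| < eta ->
    Del <= 2 * C * X ^+ 2 + 2 * C * (`|X| * `|Y|) + - c0 * Y ^+ 2.
  move=> tt; apply: DelM => q; rewrite YE => qY.
  by apply: Heta => //; apply: bally.
have lam20 : 0 < lam ^+ 2 by exact: exprn_gt0.
have nta : t != a by apply: contra tS' => /eqP ->; rewrite mem_cat !inE eqxx orbT.
have ntb : t != b by apply: contra tS' => /eqP ->; rewrite mem_cat !inE eqxx !orbT.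
have ntt : t != tau by apply: contra tS' => /eqP ->; rewrite mem_cat !inE eqxx !orbT.
have Y2 : Y ^+ 2 = lam ^+ 2 * (kap * `|sl t|) ^+ 2.
  by rewrite -(real_normK (num_real Y)) YE exprMn.
have X2 : X ^+ 2 = lam ^+ 2 * `|g t| ^+ 2.
  by rewrite -(real_normK (num_real X)) XE exprMn.
have Del_le M : Del <= 2 * C * X ^+ 2 + 2 * C * (`|X| * `|Y|) + M * Y ^+ 2 ->
    w * Del <= lam ^+ 2 * (w * (2 * C * `|g t| ^+ 2 + 2 * C * (`|g t| * (kap * `|sl t|)) +
      M * (kap * `|sl t|) ^+ 2)).
  move=> /(ler_wpM2l w0) /le_trans; apply.
  by rewrite X2 Y2 XE YE le_eqVlt; apply/orP; left; apply/eqP; ring.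
have C0' := ltW C0; have kap0' := ltW kap0; have E0' := ltW E0.
(* From g^2 <= E^2 and E <= 1; both error terms now carry the same factor E. *)
have gg : `|g t| ^+ 2 <= E.
  by rewrite expr2 -[leRHS]mulr1; apply: ler_pM => //; exact: le_trans (gE t) E1.
have gs : `|g t| * (kap * `|sl t|) <= E * kap.
  by rewrite ler_pM ?mulr_ge0 // ler_piMr.
have Kge : 2 * C * `|g t| ^+ 2 + 2 * C * (`|g t| * (kap * `|sl t|)) <= 2 * C * E * (1 + kap).
  rewrite (_ : 2 * C * E * (1 + kap) = 2 * C * E + 2 * C * (E * kap)); last by ring.
  by apply: lerD; rewrite ler_wpM2l // mulr_ge0.
have tailE : t < tau -> tail_weight t1 al be tau t = 0 by exact: tail_weight0.
have near_tau : a < t -> t < tau -> [/\ `|t - tau| < eta, W1 <= w & w <= W2].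
  move=> ta tt; have [tl tr] := andP tI.
  have hw : W1 <= w <= W2 by apply: HW; rewrite !lerD2l !lerN2 tl ltW.
  have [h1 h2] := andP hw; split => //.
  rewrite distrC gtr0_norm ?subr_gt0 //; apply: lt_trans eeta.
  by rewrite ltrBlDr -ltrBlDl.
rewrite !indicE !mem_setE /= !in_itv /=.
have [ta|ta|ta] := ltgtP t a; last by rewrite ta eqxx in nta.
  have tt : t < tau by apply: lt_trans ta (lt_trans ab btau).
  rewrite tailE // !mulr0 subr0 addr0 mulr0.
  apply: le_trans (Del_le _ DelC) _.
  rewrite /g /sl (bump_left m al0 e0 (ltW ta)) (slope_left m e0 (ltW ta)) !normr0.
  by rewrite !(mulr0, mul0r, addr0, expr0n).
have [tt|tt|tt] := ltgtP t tau; last by rewrite tt eqxx in ntt.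
  have [teta w1 w2] := near_tau ta tt.
  apply: le_trans (Del_le _ (Delneg teta)) _; rewrite ler_pM2l // tailE // mulr0 addr0 mulr1.
  have wK : w * (2 * C * `|g t| ^+ 2 + 2 * C * (`|g t| * (kap * `|sl t|))) <= Ka.
    apply: ler_pM => //; rewrite addr_ge0 //.
      by rewrite !mulr_ge0 // exprn_ge0.
    by rewrite !mulr_ge0.
  have [tb|tb|tb] := ltgtP t b; last by rewrite tb eqxx in ntb.
    rewrite mulr1 mulrDr lerD // mulNr mulrN lerN2 /Kb /sl.
    rewrite (slope_mid1 m e0 ta (ltW tb)) normr1 mulr1 mulrC.
    by rewrite ler_wpM2r // mulr_ge0 ?exprn_ge0 // ltW.
  (* Between [b] and [tau] the L_yy term is nonpositive and is simply dropped; only (a, b) supplies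
     the gain. *)
  rewrite mulr0 subr0; apply: le_trans wK; rewrite ler_wpM2l // gerDl mulNr oppr_le0.
  by rewrite mulr_ge0 ?sqr_ge0 // ltW.
(* Beyond [tau] the slope is 0, so only the L_xx term survives, controlled by the bound on g^2. *)
have [_ tr] := andP tI.
have tb : (t < b) = false by apply/negbTE; rewrite -leNgt ltW // (lt_trans btau).
rewrite tb !mulr0 subr0 add0r tail_weightE //.
apply: le_trans (Del_le _ DelC) _; rewrite ler_pM2l // -/w.
rewrite /sl (slope_right m e0 tt) normr0 !mulr0 expr0n mulr0 !addr0 mulrCA /Kc.
have := bump_tail_sqr_le al0 al1 e0 m0 m1 tt; rewrite -/a -/b -/g => gt2.
rewrite (real_normK (num_real _)).
rewrite (_ : 2 * C * (E * e) * (w * (t - tau) `^ (al - 1)) =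
  2 * C * (w * (E * e * (t - tau) `^ (al - 1)))); last by ring.
by rewrite ler_wpM2l ?mulr_ge0 // ler_wpM2l.
Qed.
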